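(* Let $\mathcal G^0$ be the set of (isomorphism classes of) connected graphs and let $\psi:\langle\mathcal G^0\rangle_{\mathbb Q}\to\langle\mathcal G\rangle_{\mathbb Q}$ be the inclusion. For each $$\dagger\in\{(\cdot_{\mathrm{hom}},\Delta_{\mathrm{hom}'}),(\cdot_{\mathrm{hom}'},\Delta_{\mathrm{hom}}),(\cdot_{\mathrm{mono}},\Delta_{\mathrm{hom}'}),(\cdot_{\mathrm{mono}'},\Delta_{\mathrm{hom}}),(\cdot_{\mathrm{regmono}},\Delta_{\mathrm{hom}'}),(\cdot_{\mathrm{regmono}'},\Delta_{\mathrm{hom}})\},$$ let $\mathcal H_\dagger$ be $\langle\mathcal G\rangle_{\mathbb Q}$ with the Hopf algebra structure $\dagger$. Then $\psi$ extends naturally to a Hopf algebra isomorphism $$\widehat{\psi_\dagger}:(\langle\mathcal G\rangle_{\mathbb Q},\cdot_{\mathrm{hom}},\Delta_{\mathrm{hom}'})\to\mathcal H_\dagger .$$ In particular, each $\mathcal H_\dagger$ is, as an algebra, free commutative on the set of connected graphs.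
   Context: Graphs are finite simple graphs (isolated vertices allowed, no loops, no parallel edges); $\mathsf e$ is the empty graph, which is not counted as connected. A graph homomorphism $f:\sigma\to\tau$ is a map $V(\sigma)\to V(\tau)$ sending edges to edges. It is a monomorphism if injective on vertices; a regular monomorphism if it is an isomorphism onto the subgraph of $\tau$ induced by $f(V(\sigma))$. $\mathrm{Epi}(\sigma,\tau)$ is the set of homomorphisms surjective on vertices; $\mathrm{RegEpi}(\sigma,\tau)$ the set of those surjective on vertices and on edges. $\mathrm{Aut}(\sigma)$ is the automorphism group. $\mathcal G$ is the set of isomorphism classes of graphs and $\langle\mathcal G\rangle_{\mathbb Q}$ the $\mathbb Q$-vector space with basis $\mathcal G$; $\langle\cdot,\cdot\rangle$ below is the bilinear pairing for which $\mathcal G$ (resp. $\mathcal G\times\mathcal G$ for tensors) is orthonormal. For $\sigma_1,\sigma_2,\tau\in\mathcal G$, with $\sqcup$ disjoint union, let $M(\sigma_1,\sigma_2;\tau)$ be the number of $f\in\mathrm{RegEpi}(\sigma_1\sqcup\sigma_2,\tau)$ such that $f|_{\sigma_1},f|_{\sigma_2}$ are monomorphisms, and $R(\sigma_1,\sigma_2;\tau)$ the number of $f\in\mathrm{Epi}(\sigma_1\sqcup\sigma_2,\tau)$ such that $f|_{\sigma_1},f|_{\sigma_2}$ are regular monomorphisms. Linear operations on $\langle\mathcal G\rangle_{\mathbb Q}$: - $\cdot_{\mathrm{hom}}$: bilinear extension of disjoint union. $(\langle\mathcal G\rangle_{\mathbb Q},\cdot_{\mathrm{hom}})$ is the polynomial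 algebra freely generated by $\mathcal G^0$. - $\Delta_{\mathrm{hom}}(\tau)=\sum_{(\tau_1,\tau_2)\in\mathcal G^2}\langle\tau,\tau_1\cdot_{\mathrm{hom}}\tau_2\rangle\,\tau_1\otimes\tau_2$. - $\Delta_{\mathrm{hom}'}$: the unital algebra morphism for $\cdot_{\mathrm{hom}}$ with $\Delta_{\mathrm{hom}'}(\tau)=\tau\otimes\mathsf e+\mathsf e\otimes\tau$ for $\tau\in\mathcal G^0$; dual product $\tau_1\cdot_{\mathrm{hom}'}\tau_2=\sum_{\gamma}\langle\tau_1\otimes\tau_2,\Delta_{\mathrm{hom}'}(\gamma)\rangle\gamma$. - $\tau_1\cdot_{\mathrm{mono}}\tau_2=\sum_{\gamma}\frac{M(\tau_1,\tau_2;\gamma)}{|\mathrm{Aut}(\gamma)|}\gamma$, $\quad\tau_1\cdot_{\mathrm{mono}'}\tau_2=\sum_{\gamma}\frac{M(\tau_1,\tau_2;\gamma)}{|\mathrm{Aut}(\tau_1)||\mathrm{Aut}(\tau_2)|}\gamma$. - $\tau_1\cdot_{\mathrm{regmono}}\tau_2=\sum_{\gamma}\frac{R(\tau_1,\tau_2;\gamma)}{|\mathrm{Aut}(\gamma)|}\gamma$, $\quad\tau_1\cdot_{\mathrm{regmono}'}\tau_2=\sum_{\gamma}\frac{R(\tau_1,\tau_2;\gamma)}{|\mathrm{Aut}(\tau_1)||\mathrm{Aut}(\tau_2)|}\gamma$. - The unit is $u(1)=\mathsf e$; the counit is $\varepsilon(\mathsf e)=1$, $\varepsilon(\tau)=0$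 for $\tau\ne\mathsf e$. All six pairs in the claim are Hopf algebras with this unit and counit. Natural extension: if $(A_1,m_1)$, $(A_2,m_2)$ are unital commutative associative algebras, $A_1$ is freely generated by $\{x_i\}$, and $\varphi$ is a linear map from the span of $\{x_i\}$ to $A_2$, its natural extension $\widehat\varphi:A_1\to A_2$ is the unique unital algebra homomorphism with $\widehat\varphi(x_i)=\varphi(x_i)$. *)

(* Defs.v *)
(* Based on MathComp, multinomials' monalg ({malg R[K]}) and mathcomp.classical. *)
From HB Require Import structures.
From mathcomp Require Import all_boot all_order all_algebra finmap.
From mathcomp Require Import generic_quotient.
From mathcomp Require Import boolp classical_sets fsbigop.
From mathcomp Require Import monalg.

Set Implicit Arguments.
Unset Strict Implicit.
Unset Printing Implicit Defensive.

Import GRing.Theory.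
Local Open Scope ring_scope.
Local Open Scope quotient_scope.

Record graph (V : finType) := Graph {
  adj_fun : {ffun V * V -> bool};
  _ : [forall x, forall y, adj_fun (x, y) == adj_fun (y, x)] &&
      [forall x, ~~ adj_fun (x, x)] }.

HB.instance Definition _ (V : finType) := [isSub for @adj_fun V].
HB.instance Definition _ (V : finType) := [Finite of graph V by <:].

Definition adj (V : finType) (g : graph V) : rel V :=
  fun x y => adj_fun g (x, y).

Lemma adj_sym (V : finType) (g : graph V) : symmetric (adj g).
Proof.
move=> x y; case: g => f fP; have /andP[/forallP fS _] := fP.
by have /forallP/(_ y)/eqP := fS x.
Qed.

Lemma adj_irr (V : finType) (g : graph V) : irreflexive (adj g).
Proof.
move=> x; case: g => f fP; have /andP[_ /forallP fI] := fP.
exact/negbTE/fI.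
Qed.

Lemma graph_of_subproof (V : finType) (r : rel V) :
  symmetric r -> irreflexive r ->
  [forall x, forall y, [ffun p : V * V => r p.1 p.2] (x, y)
                       == [ffun p : V * V => r p.1 p.2] (y, x)] &&
  [forall x, ~~ [ffun p : V * V => r p.1 p.2] (x, x)].
Proof.
move=> rS rI; apply/andP; split; apply/forallP=> x.
  by apply/forallP=> y; rewrite !ffunE /= rS.
by rewrite ffunE /= rI.
Qed.

Definition graph_of (V : finType) (r : rel V)
    (rS : symmetric r) (rI : irreflexive r) : graph V :=
  Graph (graph_of_subproof rS rI).

Lemma adj_graph_of (V : finType) (r : rel V) rS rI :
  adj (@graph_of V r rS rI) =2 r.
Proof. by move=> x y; rewrite /adj /= ffunE. Qed.

Section Constructions.

Lemma rel_pre_sym (U V : finType) (f : U -> V) (g : graph V) :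
  symmetric (relpre f (adj g)).
Proof. by move=> x y /=; rewrite adj_sym. Qed.

Lemma rel_pre_irr (U V : finType) (f : U -> V) (g : graph V) :
  irreflexive (relpre f (adj g)).
Proof. by move=> x /=; rewrite adj_irr. Qed.

Definition pull (U V : finType) (f : U -> V) (g : graph V) : graph U :=
  graph_of (rel_pre_sym f g) (rel_pre_irr f g).

Definition induced (V : finType) (g : graph V) (S : {set V}) :
    graph {x : V | x \in S} :=
  pull (fun x : {x : V | x \in S} => val x) g.

Definition union_rel (V W : finType) (g : graph V) (h : graph W) :
    rel (V + W)%type :=
  fun a b => match a, b with
             | inl x, inl y => adj g x y
             | inr x, inr y => adj h x y
             | _, _ => false
             end.

Lemma union_sym (V W : finType) (g : graph V) (h : graph W) :
  symmetric (union_rel g h).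
Proof. by move=> [x|x] [y|y] //=; rewrite adj_sym. Qed.

Lemma union_irr (V W : finType) (g : graph V) (h : graph W) :
  irreflexive (union_rel g h).
Proof. by move=> [x|x] /=; rewrite adj_irr. Qed.

Definition gunion (V W : finType) (g : graph V) (h : graph W) :
    graph (V + W)%type :=
  graph_of (union_sym g h) (union_irr g h).

Lemma void_sym : symmetric (fun _ _ : 'I_0 => false). Proof. by []. Qed.
Lemma void_irr : irreflexive (fun _ _ : 'I_0 => false). Proof. by []. Qed.
Definition gempty : graph 'I_0 := graph_of void_sym void_irr.

End Constructions.

Section Homs.
Variables (V W : finType) (g : graph V) (h : graph W).
Implicit Type f : {ffun V -> W}.

Definition is_hom f :=
  [forall x, forall y, adj g x y ==> adj h (f x) (f y)].

Definition is_mono f := is_hom f && injectiveb f.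

Definition is_epi f := is_hom f && [forall y, exists x, f x == y].

(* An edge {y, y'} of h must be the image {f x, f x'} of an edge of g; by
   symmetry of g it can be matched with the order of y and y' respected. *)
Definition is_regepi f :=
  is_epi f && [forall y, forall y', adj h y y' ==>
    [exists x, exists x', [&& adj g x x', f x == y & f x' == y']]].

Definition is_iso f :=
  [&& injectiveb f, [forall y, exists x, f x == y]
    & [forall x, forall y, adj g x y == adj h (f x) (f y)]].

End Homs.

Definition is_regmono (V W : finType) (g : graph V) (h : graph W)
    (f : {ffun V -> W}) :=
  [exists p : {ffun V -> {y : W | y \in f @: [set: V]}},
    is_iso g (induced h (f @: [set: V])) p && [forall x, val (p x) == f x]].

Definition gconnected (V : finType) (g : graph V) :=
  (0 < #|V|)%N && [forall x, forall y, connect (adj g) x y].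

Definition aut_card (V : finType) (g : graph V) : nat :=
  #|[set f : {ffun V -> V} | is_iso g g f]|.

Section Counting.
Variables (V1 V2 W : finType) (g1 : graph V1) (g2 : graph V2) (h : graph W).

Definition restrl (f : {ffun V1 + V2 -> W}) : {ffun V1 -> W} :=
  [ffun x => f (inl x)].
Definition restrr (f : {ffun V1 + V2 -> W}) : {ffun V2 -> W} :=
  [ffun x => f (inr x)].

Definition M_card : nat :=
  #|[set f : {ffun V1 + V2 -> W} | [&& is_regepi (gunion g1 g2) h f,
       is_mono g1 h (restrl f) & is_mono g2 h (restrr f)]]|.

Definition R_card : nat :=
  #|[set f : {ffun V1 + V2 -> W} | [&& is_epi (gunion g1 g2) h f,
       is_regmono g1 h (restrl f) & is_regmono g2 h (restrr f)]]|.

End Counting.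

(* Every finite graph is isomorphic to one with vertex set 'I_n, so the graphs
   on the 'I_n modulo isomorphism are all the isomorphism classes. *)
Definition ograph := {n : nat & graph 'I_n}.

Definition iso_exists (V W : finType) (g : graph V) (h : graph W) :=
  [exists f : {ffun V -> W}, is_iso g h f].

Lemma iso_existsP (V W : finType) (g : graph V) (h : graph W) :
  reflect (exists2 f : V -> W, bijective f &
             forall x y, adj g x y = adj h (f x) (f y))
          (iso_exists g h).
Proof.
apply: (iffP existsP) => [[f /and3P[/injectiveP fI /forallP fS /forallP fA]]|].
  have fS' y : exists x, f x == y by apply/existsP.
  exists f; last by move=> x y; have /forallP/(_ y)/eqP := fA x.
  exists (fun y => xchoose (fS' y)) => [x|y]; last exact/eqP/(xchooseP (fS' y)).
  by apply: fI; apply/eqP/(xchooseP (fS' _)).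
case=> f [f' fK f'K] fA; exists [ffun x => f x]; apply/and3P; split.
- by apply/injectiveP=> x y; rewrite !ffunE => /(can_inj fK).
- by apply/forallP=> y; apply/existsP; exists (f' y); rewrite ffunE f'K.
- by apply/forallP=> x; apply/forallP=> y; rewrite !ffunE fA.
Qed.

Lemma iso_refl (V : finType) (g : graph V) : iso_exists g g.
Proof. by apply/iso_existsP; exists id => //; exists id. Qed.

Lemma iso_sym (V W : finType) (g : graph V) (h : graph W) :
  iso_exists g h = iso_exists h g.
Proof.
suff sym U T (a : graph U) (b : graph T) : iso_exists a b -> iso_exists b a.
  by apply/idP/idP; apply: sym.
case/iso_existsP=> f [f' fK f'K] fA; apply/iso_existsP.
exists f'; first by exists f.
by move=> x y; rewrite fA !f'K.
Qed.

Lemma iso_trans (U V W : finType) (g : graph U) (h : graph V) (k : graph W) :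
  iso_exists g h -> iso_exists h k -> iso_exists g k.
Proof.
case/iso_existsP=> f fB fA /iso_existsP[e eB eA]; apply/iso_existsP.
by exists (e \o f) => [|x y /=]; [apply: bij_comp | rewrite fA eA].
Qed.

Definition ograph_iso : rel ograph := fun a b => iso_exists (tagged a) (tagged b).

Lemma ograph_iso_equiv : equiv_class_of ograph_iso.
Proof.
split; [by move=> a; apply: iso_refl | by move=> a b; apply: iso_sym |].
by move=> b a c; apply: iso_trans.
Qed.

Canonical ograph_iso_rel := EquivRelPack ograph_iso_equiv.

Definition gclass := {eq_quot ograph_iso}.
HB.instance Definition _ := Choice.on gclass.

Definition relabel (V : finType) (g : graph V) : graph 'I_#|V| :=
  pull (fun i : 'I_#|V| => enum_val i) g.

Definition class_of (V : finType) (g : graph V) : gclass :=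
  \pi_gclass (Tagged (fun n => graph 'I_n) (relabel g)).

Definition gorder (c : gclass) : nat := tag (repr c).
Definition rep (c : gclass) : graph 'I_(gorder c) := tagged (repr c).

Lemma iso_relabel (V : finType) (g : graph V) : iso_exists (relabel g) g.
Proof.
apply/iso_existsP; exists (fun i : 'I_#|V| => enum_val i) => [|x y].
  by apply: (@Bijective _ _ _ enum_rank); [apply: enum_valK|apply: enum_rankK].
by rewrite adj_graph_of.
Qed.

Lemma class_ofP (V W : finType) (g : graph V) (h : graph W) :
  reflect (class_of g = class_of h) (iso_exists g h).
Proof.
have -> : (iso_exists g h) = (class_of g == class_of h).
  rewrite /class_of eqmodE /= /ograph_iso /=; apply/idP/idP => gh.
    apply: (iso_trans (iso_relabel g)); apply: (iso_trans gh).
    by rewrite iso_sym iso_relabel.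
  rewrite iso_sym in gh; rewrite iso_sym; apply: iso_trans (iso_relabel g).
  by apply: iso_trans gh; rewrite iso_sym iso_relabel.
exact: eqP.
Qed.

Lemma rep_class_of (V : finType) (g : graph V) : iso_exists (rep (class_of g)) g.
Proof.
apply: iso_trans (iso_relabel g); rewrite /rep.
have /eqP := reprK (class_of g); rewrite [X in _ == X]/class_of.
rewrite -[repr _]/(repr (class_of g)).
by rewrite eqmodE.
Qed.

Lemma class_of_rep (c : gclass) : class_of (rep c) = c.
Proof.
rewrite -[RHS]reprK; apply/eqP; rewrite /class_of eqmodE; exact: iso_relabel.
Qed.

(* <K>_Q, the Q-vector space with basis K; <<k>> is the basis vector k, and
   <K>_Q (x) <L>_Q is modelled as <K * L>_Q, with (k, l) standing for k (x) l. *)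
Notation freeQ K := {malg rat[K]}.

Section FreeModules.

Definition lext (K : choiceType) (U : lmodType rat) (f : K -> U) (x : freeQ K) : U :=
  \sum_(k <- msupp x) x@_k *: f k.

Definition lext2 (K L : choiceType) (U : lmodType rat) (f : K -> L -> U)
    (x : freeQ K) (y : freeQ L) : U :=
  lext (fun k => lext (f k) y) x.

Definition tens (K L : choiceType) (x : freeQ K) (y : freeQ L) : freeQ (K * L)%type :=
  lext2 (fun k l => << (k, l) >>) x y.

Definition tens_map (K K' L L' : choiceType)
    (f : freeQ K -> freeQ K') (g : freeQ L -> freeQ L') (x : freeQ (K * L)%type) :
    freeQ (K' * L')%type :=
  lext (fun p => tens (f << p.1 >>) (g << p.2 >>)) x.

Definition tens_assoc (K : choiceType) (x : freeQ (K * K * K)%type) :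
    freeQ (K * (K * K))%type :=
  lext (fun p => << (p.1.1, (p.1.2, p.2)) >>) x.

(* The bilinear form for which the basis K is orthonormal. *)
Definition pairing (K : choiceType) (x y : freeQ K) : rat :=
  \sum_(k <- msupp x) x@_k * y@_k.

(* The sum over all k : K of c k *: << k >>; it is 0 if c has infinite support,
   which never happens below (mul_mono_coeff and the other _coeff lemmas). *)
Definition formal_sum (K : choiceType) (c : K -> rat) : freeQ K :=
  \sum_(k \in @setT K) c k *: << k >>.

End FreeModules.

Record algebra (K : choiceType) := Algebra {
  amul : freeQ K -> freeQ K -> freeQ K;
  aone : freeQ K }.

Record hopf_data (K : choiceType) := HopfData {
  halg :> algebra K;
  hcop : freeQ K -> freeQ (K * K)%type;
  heps : freeQ K -> rat }.

Definition tens_algebra (K : choiceType) (A : algebra K) : algebra (K * K)%type :=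
  Algebra
    (lext2 (fun p q : K * K =>
       tens (amul A << p.1 >> << q.1 >>) (amul A << p.2 >> << q.2 >>)))
    (tens (aone A) (aone A)).

Section Structures.
Variable K : choiceType.

Definition is_algebra (A : algebra K) : Prop :=
  [/\ forall y, linear (amul A ^~ y), forall x, linear (amul A x),
      associative (amul A),
      left_id (aone A) (amul A) & right_id (aone A) (amul A)].

Definition is_comm_algebra (A : algebra K) : Prop :=
  is_algebra A /\ commutative (amul A).

Definition is_coalgebra (H : hopf_data K) : Prop :=
  [/\ linear (hcop H), linear (heps H : freeQ K -> rat^o),
      forall x, tens_assoc (tens_map (hcop H) id (hcop H x)) =
                tens_map id (hcop H) (hcop H x),
      forall x, lext (fun p : K * K => heps H << p.1 >> *: << p.2 >>)
                     (hcop H x) = x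
    & forall x, lext (fun p : K * K => heps H << p.2 >> *: << p.1 >>)
                     (hcop H x) = x].

Definition is_bialgebra (H : hopf_data K) : Prop :=
  [/\ is_algebra H, is_coalgebra H,
      hcop H (aone H) = aone (tens_algebra H) /\
      (forall x y, hcop H (amul H x y) =
                   amul (tens_algebra H) (hcop H x) (hcop H y))
    & heps H (aone H) = 1 /\
      (forall x y, heps H (amul H x y) = heps H x * heps H y)].

Definition is_antipode (H : hopf_data K) (S : freeQ K -> freeQ K) : Prop :=
  [/\ linear S,
      forall x, lext (fun p : K * K => amul H (S << p.1 >>) << p.2 >>)
                     (hcop H x) = heps H x *: aone H
    & forall x, lext (fun p : K * K => amul H << p.1 >> (S << p.2 >>))
                     (hcop H x) = heps H x *: aone H].

Definition is_hopf (H : hopf_data K) : Prop :=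
  is_bialgebra H /\ exists S, is_antipode H S.

End Structures.

Definition algebra_morphism (K L : choiceType) (A : algebra K) (B : algebra L)
    (f : freeQ K -> freeQ L) : Prop :=
  [/\ linear f, f (aone A) = aone B
    & forall x y, f (amul A x y) = amul B (f x) (f y)].

Definition hopf_morphism (K L : choiceType) (H : hopf_data K) (H' : hopf_data L)
    (f : freeQ K -> freeQ L) : Prop :=
  [/\ algebra_morphism H H' f,
      forall x, hcop H' (f x) = tens_map f f (hcop H x),
      forall x, heps H' (f x) = heps H x
    & forall S S', is_antipode H S -> is_antipode H' S' ->
        forall x, f (S x) = S' (f x)].

Definition hopf_isomorphism (K L : choiceType)
    (H : hopf_data K) (H' : hopf_data L) (f : freeQ K -> freeQ L) : Prop :=
  hopf_morphism H H' f /\ bijective f.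

(* A is the free commutative algebra on the family x, by its universal
   property among commutative Q-algebras. *)
Definition freely_generated (K : choiceType) (A : algebra K)
    (I : Type) (x : I -> freeQ K) : Prop :=
  is_comm_algebra A /\
  forall (B : comAlgType rat) (b : I -> B),
    let extends (f : freeQ K -> B) :=
      [/\ linear f, f (aone A) = 1,
          forall u v, f (amul A u v) = f u * f v & forall i, f (x i) = b i] in
    exists2 f, extends f & forall f', extends f' -> f' =1 f.

(* For A1 freely generated by the family x, so that the span of the x i is
   identified with <I>_Q. *)
Definition natural_extension (I K L : choiceType)
    (A1 : algebra K) (x : I -> freeQ K) (A2 : algebra L)
    (phi : freeQ I -> freeQ L) (phihat : freeQ K -> freeQ L) : Prop :=
  let extends f := algebra_morphism A1 A2 f /\ forall i, f (x i) = phi << i >> in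
  extends phihat /\ forall f, extends f -> f =1 phihat.

Definition cgraph : Type := {c : gclass | gconnected (rep c)}.
HB.instance Definition _ := Choice.on cgraph.

Definition empty_class : gclass := class_of gempty.

Definition cgen (t : cgraph) : freeQ gclass := << val t >>.

(* The span of the connected graphs is <cgraph>_Q; psi is its inclusion. *)
Definition psi : freeQ cgraph -> freeQ gclass := lext cgen.

Definition Aut (c : gclass) : nat := aut_card (rep c).
Definition Mcount (s1 s2 t : gclass) : nat := M_card (rep s1) (rep s2) (rep t).
Definition Rcount (s1 s2 t : gclass) : nat := R_card (rep s1) (rep s2) (rep t).

Definition mul_hom : freeQ gclass -> freeQ gclass -> freeQ gclass :=
  lext2 (fun s t => << class_of (gunion (rep s) (rep t)) >>).

Definition alg_hom : algebra gclass := Algebra mul_hom << empty_class >>.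

Definition cop_hom : freeQ gclass -> freeQ (gclass * gclass)%type :=
  lext (fun t => formal_sum (fun p : gclass * gclass =>
    pairing << t >> (mul_hom << p.1 >> << p.2 >>))).

(* The unital algebra morphism for mul_hom for which the connected graphs are
   primitive; there is exactly one (cop_hom'P, is_cop_hom'_uniq). *)
Definition is_cop_hom' (D : freeQ gclass -> freeQ (gclass * gclass)%type) : Prop :=
  algebra_morphism alg_hom (tens_algebra alg_hom) D /\
  forall t : cgraph,
    D << val t >> = << (val t, empty_class) >> + << (empty_class, val t) >>.

Definition cop_hom' : freeQ gclass -> freeQ (gclass * gclass)%type :=
  xget (fun=> 0) is_cop_hom'.

Definition mul_hom' : freeQ gclass -> freeQ gclass -> freeQ gclass :=
  lext2 (fun s t => formal_sum (fun c : gclass =>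
    pairing << (s, t) >> (cop_hom' << c >>))).

Definition mul_mono : freeQ gclass -> freeQ gclass -> freeQ gclass :=
  lext2 (fun s t => formal_sum (fun c : gclass =>
    (Mcount s t c)%:R / (Aut c)%:R)).

Definition mul_mono' : freeQ gclass -> freeQ gclass -> freeQ gclass :=
  lext2 (fun s t => formal_sum (fun c : gclass =>
    (Mcount s t c)%:R / ((Aut s)%:R * (Aut t)%:R))).

Definition mul_regmono : freeQ gclass -> freeQ gclass -> freeQ gclass :=
  lext2 (fun s t => formal_sum (fun c : gclass =>
    (Rcount s t c)%:R / (Aut c)%:R)).

Definition mul_regmono' : freeQ gclass -> freeQ gclass -> freeQ gclass :=
  lext2 (fun s t => formal_sum (fun c : gclass =>
    (Rcount s t c)%:R / ((Aut s)%:R * (Aut t)%:R))).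

Definition hopf_with (m : freeQ gclass -> freeQ gclass -> freeQ gclass)
    (D : freeQ gclass -> freeQ (gclass * gclass)%type) : hopf_data gclass :=
  HopfData (Algebra m << empty_class >>) D (mcoeff empty_class).

(* The products and coproducts, in this order; a prime is that of the name of
   the operation. *)
Inductive dagger :=
  | hom_hom' | hom'_hom | mono_hom' | mono'_hom | regmono_hom' | regmono'_hom.

Definition hopf_of (d : dagger) : hopf_data gclass :=
  match d with
  | hom_hom' => hopf_with mul_hom cop_hom'
  | hom'_hom => hopf_with mul_hom' cop_hom
  | mono_hom' => hopf_with mul_mono cop_hom'
  | mono'_hom => hopf_with mul_mono' cop_hom
  | regmono_hom' => hopf_with mul_regmono cop_hom'
  | regmono'_hom => hopf_with mul_regmono' cop_hom
  end.

Section FreeModuleTheory.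
Local Open Scope fset_scope.

Lemma lextEw (K : choiceType) (U : lmodType rat) (f : K -> U) (d : {fset K})
    (x : freeQ K) : msupp x `<=` d -> lext f x = \sum_(k <- d) x@_k *: f k.
Proof.
move=> le; rewrite [LHS](big_fset_incl _ le) => //= k _ /mcoeff_outdom ->.
by rewrite scale0r.
Qed.

Lemma lextU (K : choiceType) (U : lmodType rat) (f : K -> U) k :
  lext f << k >> = f k.
Proof. by rewrite (lextEw _ msuppU_le) big_seq_fset1 mcoeffUU scale1r. Qed.

Lemma lext_linear (K : choiceType) (U : lmodType rat) (f : K -> U) :
  linear (lext f).
Proof.
move=> a x y; pose d := msupp (a *: x + y) `|` (msupp x `|` msupp y).
rewrite 3?(@lextEw _ _ _ d) /d; first last.
- exact: fsubsetUl.
- by apply: fsubset_trans (fsubsetUr _ _); apply: fsubsetUl.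
- by apply: fsubset_trans (fsubsetUr _ _); apply: fsubsetUr.
rewrite scaler_sumr -big_split /=; apply: eq_bigr => k _.
by rewrite mcoeffD mcoeffZ scalerDl scalerA.
Qed.

HB.instance Definition _ (K : choiceType) (U : lmodType rat) (f : K -> U) :=
  GRing.isLinear.Build rat (freeQ K) U _ (lext f) (lext_linear f).

Lemma mcoeffs_linear (K : choiceType) (k : K) : linear (mcoeff k : freeQ K -> rat^o).
Proof. by move=> a x y; rewrite mcoeffD mcoeffZ. Qed.

Lemma freeE (K : choiceType) (x : freeQ K) : x = lext (fun k => << k >>) x.
Proof.
rewrite /lext {1}(monalgE x); apply: eq_bigr => k _; apply/malgP=> l.
by rewrite mcoeffZ !mcoeffU mulrnAr mulr1.
Qed.

Lemma lin_lext (K : choiceType) (U : lmodType rat) (f : freeQ K -> U) :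
  linear f -> f =1 lext (fun k => f << k >>).
Proof.
move=> fL x; pose F := HB.pack_for {linear freeQ K -> U} f
  (GRing.isLinear.Build _ _ _ _ f fL).
rewrite {1}[x]freeE /lext -[f]/(F : _ -> _) linear_sum.
by apply: eq_bigr => k _; rewrite linearZ.
Qed.

Lemma formal_sumE (K : choiceType) (c : K -> rat) (d : {fset K}) (k : K) :
  (forall i, i \notin d -> c i = 0) -> (formal_sum c)@_k = c k.
Proof.
move=> c0; rewrite /formal_sum (fsbigTE d) => [|i /c0->]; last by rewrite scale0r.
rewrite raddf_sum /=.
under eq_bigr => i _ do rewrite mcoeffZ mcoeffU mulr_natr.
have [kd|kd] := boolP (k \in d); last first.
  rewrite c0 // big1_seq // => i /andP[_ id]; case: eqP => // eik.
  by rewrite eik (negbTE kd) in id.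
rewrite (big_fsetD1 k) //= eqxx mulr1n big1_seq ?addr0 // => i /andP[_].
by rewrite !inE => /andP[/negbTE-> _].
Qed.

Lemma lext2U (K L : choiceType) (U : lmodType rat) (f : K -> L -> U) k l :
  lext2 f << k >> << l >> = f k l.
Proof. by rewrite /lext2 lextU lextU. Qed.

Lemma tensU (K L : choiceType) (k : K) (l : L) :
  tens << k >> << l >> = << (k, l) >> :> freeQ (K * L)%type.
Proof. by rewrite /tens lext2U. Qed.

Lemma lext2_bilin (K L : choiceType) (U : lmodType rat) (f : K -> L -> U) :
  (forall y, linear (lext2 f ^~ y)) /\ (forall x, linear (lext2 f x)).
Proof.
split=> [y|x a u v]; first exact: lext_linear.
rewrite /lext2 {1}/lext.
under eq_bigr => k _ do rewrite lext_linear scalerDr scalerA mulrC -scalerA.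
by rewrite big_split /= -scaler_sumr.
Qed.

End FreeModuleTheory.

Lemma gorder_class_of (V : finType) (g : graph V) : gorder (class_of g) = #|V|.
Proof.
have /iso_existsP[f /bij_eq_card] := rep_class_of g; by rewrite card_ord.
Qed.

Definition classes_le (n : nat) : {fset gclass} :=
  seq_fset tt [seq class_of (tagged u) | u : {i : 'I_n.+1 & graph 'I_i}].

Lemma mem_classes_le n c : (c \in classes_le n) = (gorder c <= n)%N.
Proof.
rewrite seq_fsetE; apply/mapP/idP => [[[i g] _ ->] /=|cn].
  by rewrite gorder_class_of card_ord -ltnS.
exists (Tagged (fun i : 'I_n.+1 => graph 'I_i) (rep c : graph 'I_(Ordinal (cn : gorder c < n.+1)%N))).
  by rewrite mem_enum.
by rewrite /= class_of_rep.
Qed.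

Lemma epi_card (V W : finType) (g : graph V) (h : graph W) f :
  is_epi g h f -> (#|W| <= #|V|)%N.
Proof.
case/andP=> _ /forallP fS; rewrite -(cardsT W) -(cardsT V).
suff -> : [set: W]%SET = (f @: [set: V])%SET by apply: leq_imset_card.
by apply/setP=> y; rewrite inE; have /existsP[x /eqP<-] := fS y; rewrite imset_f.
Qed.

Lemma Mcount_support s t c :
  c \notin classes_le (gorder s + gorder t) -> Mcount s t c = 0%N.
Proof.
rewrite mem_classes_le => cst; apply: eq_card0 => f; rewrite inE.
apply/negP=> /and3P[/andP[/epi_card]].
by rewrite card_sum !card_ord (negbTE cst).
Qed.

Lemma Rcount_support s t c :
  c \notin classes_le (gorder s + gorder t) -> Rcount s t c = 0%N.
Proof.
rewrite mem_classes_le => cst; apply: eq_card0 => f; rewrite inE.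
apply/negP=> /and3P[/epi_card].
by rewrite card_sum !card_ord (negbTE cst).
Qed.

Lemma mul_mono_coeff s t c :
  (mul_mono << s >> << t >>)@_c = (Mcount s t c)%:R / (Aut c)%:R.
Proof.
rewrite /mul_mono lext2U (@formal_sumE _ _ (classes_le (gorder s + gorder t))) //.
by move=> i /Mcount_support->; rewrite mul0r.
Qed.

Lemma mul_mono'_coeff s t c :
  (mul_mono' << s >> << t >>)@_c = (Mcount s t c)%:R / ((Aut s)%:R * (Aut t)%:R).
Proof.
rewrite /mul_mono' lext2U (@formal_sumE _ _ (classes_le (gorder s + gorder t))) //.
by move=> i /Mcount_support->; rewrite mul0r.
Qed.

Lemma mul_regmono_coeff s t c :
  (mul_regmono << s >> << t >>)@_c = (Rcount s t c)%:R / (Aut c)%:R.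
Proof.
rewrite /mul_regmono lext2U (@formal_sumE _ _ (classes_le (gorder s + gorder t))) //.
by move=> i /Rcount_support->; rewrite mul0r.
Qed.

Lemma mul_regmono'_coeff s t c :
  (mul_regmono' << s >> << t >>)@_c = (Rcount s t c)%:R / ((Aut s)%:R * (Aut t)%:R).
Proof.
rewrite /mul_regmono' lext2U (@formal_sumE _ _ (classes_le (gorder s + gorder t))) //.
by move=> i /Rcount_support->; rewrite mul0r.
Qed.

Lemma mul_homU s t :
  mul_hom << s >> << t >> = << class_of (gunion (rep s) (rep t)) >>.
Proof. by rewrite /mul_hom lext2U. Qed.

Lemma pairingU (K : choiceType) (k : K) (x : freeQ K) : pairing << k >> x = x@_k.
Proof. by rewrite /pairing msuppU oner_eq0 big_seq_fset1 mcoeffUU mul1r. Qed.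

Lemma cop_hom_coeff t s1 s2 :
  (cop_hom << t >>)@_(s1, s2) = (class_of (gunion (rep s1) (rep s2)) == t)%:R.
Proof.
rewrite /cop_hom lextU; set c := fun p => _.
have cE p : c p = (class_of (gunion (rep p.1) (rep p.2)) == t)%:R.
  by rewrite /c mul_homU pairingU mcoeffU.
rewrite (@formal_sumE _ _ (classes_le (gorder t) `*` classes_le (gorder t))%fset).
  by rewrite cE.
move=> [p1 p2]; rewrite cE in_fsetM /= !mem_classes_le; case: eqP => //= <-.
by rewrite gorder_class_of card_sum !card_ord leq_addr leq_addl.
Qed.

Lemma is_isoI (V W : finType) (g : graph V) (h : graph W) (f : V -> W) :
  injective f -> (forall y, exists x, f x = y) ->
  (forall x y, adj g x y = adj h (f x) (f y)) -> iso_exists g h.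
Proof.
move=> fI fS fA; apply/existsP; exists [ffun x => f x]; apply/and3P; split.
- by apply/injectiveP=> x y; rewrite !ffunE => /fI.
- apply/forallP=> y; apply/existsP; have [x <-] := fS y.
  by exists x; rewrite ffunE.
- by apply/forallP=> x; apply/forallP=> y; rewrite !ffunE fA.
Qed.

Lemma adj_pull (U V : finType) (f : U -> V) (g : graph V) x y :
  adj (pull f g) x y = adj g (f x) (f y).
Proof. by rewrite adj_graph_of. Qed.

Lemma gunion_iso (V W V' W' : finType) (g : graph V) (h : graph W)
    (g' : graph V') (h' : graph W') :
  iso_exists g g' -> iso_exists h h' -> iso_exists (gunion g h) (gunion g' h').
Proof.
case/iso_existsP=> f [f1 fK f1K] fA /iso_existsP[e [e1 eK e1K] eA].
pose F (z : V + W) : V' + W' := match z with inl x => inl (f x) | inr y => inr (e y) end.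
apply: (@is_isoI _ _ _ _ F).
- by case=> x [] y //= []; [move/(can_inj fK)->|move/(can_inj eK)->].
- case=> y; first by exists (inl (f1 y)); rewrite /= f1K.
  by exists (inr (e1 y)); rewrite /= e1K.
- by case=> x [] y; rewrite !adj_graph_of /=.
Qed.

Lemma class_of_union (V W : finType) (g : graph V) (h : graph W) :
  class_of (gunion (rep (class_of g)) (rep (class_of h))) = class_of (gunion g h).
Proof. by apply/class_ofP/gunion_iso; apply: rep_class_of. Qed.

Lemma mul_hom_class (V W : finType) (g : graph V) (h : graph W) :
  mul_hom << class_of g >> << class_of h >> = << class_of (gunion g h) >>.
Proof. by rewrite mul_homU class_of_union. Qed.

Section Split.
Variables (V : finType) (g : graph V).
Definition splits (S : {set V}) :=
  [forall x, forall y, adj g x y ==> ((x \in S) == (y \in S))].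

Lemma splitsP (S : {set V}) :
  reflect (forall x y, adj g x y -> (x \in S) = (y \in S)) (splits S).
Proof.
apply: (iffP forallP) => [H x y xy|H x].
  by have /forallP/(_ y)/implyP/(_ xy)/eqP := H x.
by apply/forallP=> y; apply/implyP=> xy; rewrite (H _ _ xy).
Qed.

Definition split_sum : freeQ (gclass * gclass)%type :=
  \sum_(S : {set V} | splits S)
     << (class_of (induced g S), class_of (induced g (~: S))) >>.
End Split.

Lemma iso_induced (V W : finType) (g : graph V) (h : graph W) (f : V -> W)
    (S : {set V}) (T : {set W}) :
  bijective f -> (forall x y, adj g x y = adj h (f x) (f y)) ->
  (forall x, (x \in S) = (f x \in T)) -> iso_exists (induced g S) (induced h T).
Proof.
move=> [f' fK f'K] fA fST.
have fT (x : {x | x \in S}) : f (val x) \in T by rewrite -fST (valP x).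
apply: (@is_isoI _ _ _ _ (fun x => exist (fun y => y \in T) (f (val x)) (fT x))).
- by move=> x y [] /(can_inj fK) /val_inj.
- move=> [y yT]; have yS : f' y \in S by rewrite fST f'K.
  by exists (exist _ (f' y) yS); apply: val_inj; rewrite /= f'K.
- by move=> x y; rewrite !adj_pull fA.
Qed.

Lemma split_sum_iso (V W : finType) (g : graph V) (h : graph W) :
  iso_exists g h -> split_sum g = split_sum h.
Proof.
case/iso_existsP=> f [f' fK f'K] fA; have fB : bijective f by exists f'.
rewrite /split_sum (reindex (fun T : {set W} => f @^-1: T)); last first.
  exists (fun S : {set V} => f' @^-1: S) => S _; apply/setP=> x.
    by rewrite !inE f'K.
  by rewrite !inE fK.
apply: eq_big => [T|T _].
  apply/splitsP/splitsP => H x y; last by rewrite fA => /H; rewrite !inE.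
  by move=> xy; have := H (f' x) (f' y); rewrite fA !inE !f'K => ->.
have i1 : class_of (induced g (f @^-1: T)) = class_of (induced h T).
  by apply/class_ofP; apply: (iso_induced fB fA) => x; rewrite inE.
have i2 : class_of (induced g (~: (f @^-1: T))) = class_of (induced h (~: T)).
  by apply/class_ofP; apply: (iso_induced fB fA) => x; rewrite !inE.
by rewrite i1 i2.
Qed.

Lemma induced_union (V W : finType) (g : graph V) (h : graph W) (S : {set V + W}) :
  class_of (induced (gunion g h) S) =
  class_of (gunion (induced g (inl @^-1: S)) (induced h (inr @^-1: S))).
Proof.
apply/esym/class_ofP.
have lS (x : {x : V | x \in inl @^-1: S}) : inl (val x) \in S.
  by have := valP x; rewrite inE.
have rS (x : {x : W | x \in inr @^-1: S}) : inr (val x) \in S.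
  by have := valP x; rewrite inE.
pose F z : {z : V + W | z \in S} := match z with
  | inl x => exist (fun z => z \in S) (inl (val x)) (lS x)
  | inr x => exist (fun z => z \in S) (inr (val x)) (rS x) end.
apply: (@is_isoI _ _ _ _ F).
- by case=> x [] y //= [] /val_inj ->.
- case=> [[x|x] xS].
    have xS' : x \in inl @^-1: S by rewrite inE.
    by exists (inl (exist _ x xS')); apply: val_inj.
  have xS' : x \in inr @^-1: S by rewrite inE.
  by exists (inr (exist _ x xS')); apply: val_inj.
- by case=> x [] y; rewrite adj_pull !adj_graph_of /= ?adj_pull.
Qed.

Lemma tens_mulU p q :
  amul (tens_algebra alg_hom) << p >> << q >> =
  << (class_of (gunion (rep p.1) (rep q.1)), class_of (gunion (rep p.2) (rep q.2))) >>.
Proof.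
rewrite [LHS]lext2U.
exact: etrans (congr2 _ (mul_homU _ _) (mul_homU _ _)) (tensU _ _).
Qed.

Lemma bilin_sum (K : choiceType) (I J : finType) (P : pred I) (Q : pred J)
    (m : freeQ K -> freeQ K -> freeQ K) (F : I -> freeQ K) (G : J -> freeQ K) :
  (forall y, linear (m ^~ y)) /\ (forall x, linear (m x)) ->
  m (\sum_(i | P i) F i) (\sum_(j | Q j) G j) =
  \sum_(i | P i) \sum_(j | Q j) m (F i) (G j).
Proof.
case=> mL mR.
pose ml y := HB.pack_for {linear freeQ K -> freeQ K} (m ^~ y)
  (GRing.isLinear.Build _ _ _ _ _ (mL y)).
pose mr x := HB.pack_for {linear freeQ K -> freeQ K} (m x)
  (GRing.isLinear.Build _ _ _ _ _ (mR x)).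
rewrite -[LHS]/((ml _ : _ -> _) _) linear_sum; apply: eq_bigr => i _ /=.
by rewrite -[LHS]/((mr _ : _ -> _) _) linear_sum.
Qed.

Lemma split_sum_union (V W : finType) (g : graph V) (h : graph W) :
  split_sum (gunion g h) =
  amul (tens_algebra alg_hom) (split_sum g) (split_sum h).
Proof.
rewrite [in RHS]/split_sum bilin_sum; last exact: lext2_bilin.
rewrite pair_big_dep /split_sum.
rewrite (reindex (fun p : {set V} * {set W} =>
  [set z | match z with inl x => x \in p.1 | inr y => y \in p.2 end])); last first.
  exists (fun S : {set V + W} => (inl @^-1: S, inr @^-1: S)) => [[A B]|S] _ /=.
    by congr (_, _); apply/setP=> x; rewrite !inE.
  by apply/setP=> [[x|x]]; rewrite !inE.
apply: eq_big => [[A B]|[A B] _].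
  rewrite /=; apply/splitsP/andP => [H|[/splitsP HA /splitsP HB]].
    split; apply/splitsP=> x y xy.
      by have := H (inl x) (inl y); rewrite adj_graph_of !inE /=; apply.
    by have := H (inr x) (inr y); rewrite adj_graph_of !inE /=; apply.
  by case=> x [] y; rewrite adj_graph_of !inE //=; [apply: HA|apply: HB].
rewrite tens_mulU; cbn [fst snd]; rewrite !class_of_union !induced_union.
set S := [set z | _]; have -> : inl @^-1: S = A by apply/setP=> x; rewrite !inE.
have -> : inr @^-1: S = B by apply/setP=> x; rewrite !inE.
have -> : inl @^-1: (~: S) = ~: A by apply/setP=> x; rewrite !inE.
by have -> : inr @^-1: (~: S) = ~: B by apply/setP=> x; rewrite !inE.
Qed.

Lemma empty_classE (V : finType) (g : graph V) :
  #|V| = 0%N -> class_of g = empty_class.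
Proof.
move=> V0; have nV (x : V) : False by have := fintype0 x V0.
have n0 (x : 'I_0) : False by case: x.
apply/class_ofP; apply: (@is_isoI _ _ _ _ (fun x => False_rect _ (nV x))).
- by move=> x; case: (nV x).
- by move=> x; case: (n0 x).
- by move=> x; case: (nV x).
Qed.

Lemma induced_setT (V : finType) (g : graph V) (S : {set V}) :
  (forall x, x \in S) -> class_of (induced g S) = class_of g.
Proof.
move=> ST; apply/class_ofP; apply: (@is_isoI _ _ _ _ val).
- exact: val_inj.
- by move=> y; exists (exist _ y (ST y)).
- by move=> x y; rewrite adj_pull.
Qed.

Lemma induced_set0 (V : finType) (g : graph V) (S : {set V}) :
  (forall x, x \notin S) -> class_of (induced g S) = empty_class.
Proof.
move=> S0; apply: empty_classE; apply: eq_card0 => -[x xS].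
by have := S0 x; rewrite xS.
Qed.

Lemma split_connect (V : finType) (g : graph V) (S : {set V}) x y :
  splits g S -> connect (adj g) x y -> (x \in S) = (y \in S).
Proof.
move/splitsP=> gS /connectP[p]; elim: p x => [|z p IHp] x /=; first by move=> _ ->.
by case/andP=> /gS-> /IHp IH /IH.
Qed.

Lemma split_sum_connected (V : finType) (g : graph V) : gconnected g ->
  split_sum g = << (class_of g, empty_class) >> + << (empty_class, class_of g) >>.
Proof.
case/andP=> /card_gt0P[x0 _] gc.
have conn x y : connect (adj g) x y.
  by have /forallP/(_ y) := forallP gc x.
have sp S : splits g S = (S == [set: V]) || (S == finset.set0).
  apply/idP/orP => [gS|[]/eqP->]; try by apply/splitsP=> x y _; rewrite !inE.
  have [xS|xS] := boolP (x0 \in S); [left|right]; apply/eqP/setP=> y.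
    by rewrite inE -(split_connect gS (conn x0 y)).
  by rewrite inE -(split_connect gS (conn x0 y)) (negbTE xS).
have T0 : [set: V] != finset.set0 by apply/set0Pn; exists x0; rewrite inE.
have spT : splits g [set: V] by rewrite sp eqxx.
rewrite /split_sum (bigD1 [set: V] spT).
have addE (U : zmodType) (a a1 b b1 : U) : a = a1 -> b = b1 -> a + b = a1 + b1.
  by move=> -> ->.
apply: addE.
  have -> : class_of (induced g [set: V]) = class_of g.
    by apply: induced_setT => x; rewrite inE.
  have -> // : class_of (induced g (~: [set: V])) = empty_class.
  by apply: induced_set0 => x; rewrite !inE.
rewrite (big_pred1 finset.set0) => [|S].
  have -> : class_of (induced g finset.set0) = empty_class.
    by apply: induced_set0 => x; rewrite inE.
  have -> // : class_of (induced g (~: finset.set0)) = class_of g.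
  by apply: induced_setT => x; rewrite !inE.
rewrite sp; transitivity (S == finset.set0); last by [].
have [->|_] := eqVneq S finset.set0; first by rewrite orbT eq_sym T0.
by rewrite orbF andbN.
Qed.

Lemma split_sum_is_cop_hom' : is_cop_hom' (lext (fun c => split_sum (rep c))).
Proof.
have lin : linear (lext (fun c => split_sum (rep c))) by exact: lext_linear.
split; last first.
  move=> [t tc]; rewrite lextU [LHS]split_sum_connected; last by [].
  by rewrite class_of_rep.
split; first exact: lin.
  rewrite [LHS]lextU (split_sum_iso (rep_class_of _)) /split_sum.
  rewrite (big_pred1 finset.set0); last first.
    move=> S; have -> : S = finset.set0 by apply/setP=> -[].
    by rewrite [RHS]eqxx; apply/splitsP=> -[].
  rewrite [RHS]tensU.
  have e0 (S : {set 'I_0}) : class_of (induced gempty S) = empty_class.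
    by apply: empty_classE; apply: eq_card0 => -[[]].
  by rewrite !e0.
move=> x y.
move: lin; set D := lext _ => lin.
have [mL mR] : (forall y, linear (mul_hom ^~ y)) /\ (forall x, linear (mul_hom x)).
  exact: lext2_bilin.
pose T := amul (tens_algebra alg_hom).
have [tL tR] : (forall y, linear (T ^~ y)) /\ (forall x, linear (T x)).
  exact: lext2_bilin.
have DmL : linear (fun x => D (mul_hom x y)) by move=> a u v; rewrite mL lin.
have TmL : linear (fun x => T (D x) (D y)) by move=> a u v; rewrite lin tL.
apply: etrans (lin_lext DmL x) (etrans _ (esym (lin_lext TmL x))).
apply: eq_bigr => k _; congr (_ *: _).
have DmR : linear (fun y => D (mul_hom << k >> y)) by move=> a u v; rewrite mR lin.
have TmR : linear (fun y => T (D << k >>) (D y)) by move=> a u v; rewrite lin tR.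
apply: etrans (lin_lext DmR y) (etrans _ (esym (lin_lext TmR y))).
apply: eq_bigr => l _; congr (_ *: _).
have DU c : D << c >> = split_sum (rep c) := lextU _ _.
apply: etrans (f_equal D (mul_homU k l)) (etrans (DU _) _).
apply: etrans (split_sum_iso (rep_class_of _)) (etrans (split_sum_union _ _) _).
exact: (congr2 T (esym (DU k)) (esym (DU l))).
Qed.

Lemma cop_hom'P : is_cop_hom' cop_hom'.
Proof. apply: xgetPex; exists (lext (fun c => split_sum (rep c))); exact: split_sum_is_cop_hom'. Qed.

Lemma class_of_split (V : finType) (g : graph V) (S : {set V}) : splits g S ->
  class_of g = class_of (gunion (induced g S) (induced g (~: S))).
Proof.
move/splitsP=> gS; apply/esym/class_ofP.
pose F (z : {x | x \in S} + {x | x \in ~: S}) : V :=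
  match z with inl x => val x | inr x => val x end.
have nS (x : {x | x \in ~: S}) : val x \in S = false.
  by have := valP x; rewrite inE => /negbTE.
apply: (@is_isoI _ _ _ _ F).
- case=> x [] y /= e; try by rewrite (val_inj e).
    by have := valP x; have := nS y; rewrite /= e => ->.
  by have := valP y; have := nS x; rewrite /= e => ->.
- move=> y; have [yS|yS] := boolP (y \in S); first by exists (inl (exist _ y yS)).
  have yS' : y \in ~: S by rewrite inE.
  by exists (inr (exist _ y yS')).
- case=> x [] y; rewrite adj_graph_of /= ?adj_pull //; apply/esym/negP => /gS.
    by rewrite (valP x) nS.
  by rewrite (valP y) nS.
Qed.

Lemma hom_morphism_ext (L : choiceType) (B : algebra L)
    (f f' : freeQ gclass -> freeQ L) :
  algebra_morphism alg_hom B f -> algebra_morphism alg_hom B f' ->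
  (forall t : cgraph, f << val t >> = f' << val t >>) -> f =1 f'.
Proof.
move=> [fL f1 fM] [f'L f'1 f'M] ff'.
suff fc n c : (gorder c <= n)%N -> f << c >> = f' << c >>.
  move=> x; rewrite (lin_lext fL) (lin_lext f'L); apply: eq_bigr => c _.
  by rewrite (fc _ _ (leqnn _)).
elim: n c => [|n IHn] c cn.
  suff -> : c = empty_class by apply: etrans f1 (esym f'1).
  rewrite -(class_of_rep c); apply: empty_classE.
  by rewrite card_ord; apply/eqP; rewrite -leqn0.
have [cc|] := boolP (gconnected (rep c)); first exact: (ff' (exist _ c cc)).
rewrite negb_and -leqNgt leqn0 => /orP[c0|].
  by apply: IHn; rewrite -(card_ord (gorder c)) (eqP c0).
case/forallPn=> x /forallPn[y xy].
pose S := [set z | connect (adj (rep c)) x z].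
have cS : splits (rep c) S.
  apply/splitsP=> u v uv; rewrite !inE; apply/idP/idP => [xu|xv].
    exact: connect_trans xu (connect1 uv).
  by apply: connect_trans xv (connect1 _); rewrite adj_sym.
have xS : x \in S by rewrite inE connect0.
have yS : y \notin S by rewrite inE.
have lt (T : {set 'I_(gorder c)}) z : z \notin T ->
    (gorder (class_of (induced (rep c) T)) <= n)%N.
  move=> zT; rewrite gorder_class_of card_sig -ltnS; apply: leq_trans cn.
  rewrite -[X in (_ < X)%N](card_ord (gorder c)); apply: proper_card.
  by apply/properP; split; [apply/fintype.subsetP | exists z].
have E : << c >> = mul_hom << class_of (induced (rep c) S) >>
                           << class_of (induced (rep c) (~: S)) >>.
  by rewrite mul_hom_class -(class_of_split cS) class_of_rep.
have xS' : x \notin ~: S by rewrite inE negbK.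
rewrite E; apply: etrans (fM _ _) (etrans _ (esym (f'M _ _))).
exact: (congr2 _ (IHn _ (lt _ _ yS)) (IHn _ (lt _ _ xS'))).
Qed.

Lemma is_cop_hom'_uniq D D' : is_cop_hom' D -> is_cop_hom' D' -> D =1 D'.
Proof.
by move=> [DM Dg] [D'M D'g]; apply: (hom_morphism_ext DM D'M) => t; rewrite Dg D'g.
Qed.

Lemma cop_hom'U c : cop_hom' << c >> = split_sum (rep c).
Proof.
rewrite (is_cop_hom'_uniq cop_hom'P split_sum_is_cop_hom').
exact: lextU.
Qed.

Lemma mul_hom'_coeff s t c :
  (mul_hom' << s >> << t >>)@_c = (cop_hom' << c >>)@_(s, t).
Proof.
rewrite /mul_hom' lext2U.
rewrite (@formal_sumE _ _ (classes_le (gorder s + gorder t))) ?pairingU // => i.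
rewrite pairingU cop_hom'U mem_classes_le => ist; rewrite raddf_sum big1 // => S _.
rewrite /= mcoeffU; case: eqP => // -[es et]; case/negP: ist.
rewrite -es -et !gorder_class_of !card_sig -[X in (X <= _)%N](card_ord (gorder i)).
by rewrite -(cardC S) leq_add2l; apply/subset_leq_card/fintype.subsetP => x; rewrite !inE.
Qed.

Lemma is_regmonoE (V W : finType) (g : graph V) (h : graph W) (f : {ffun V -> W}) :
  is_regmono g h f =
  injectiveb f && [forall x, forall y, adj g x y == adj h (f x) (f y)].
Proof.
apply/existsP/andP => [[p /andP[/and3P[/injectiveP pI _ pA] /forallP pf]]|[/injectiveP fI fA]].
  have pE x : val (p x) = f x by apply/eqP.
  split; first by apply/injectiveP => x y; rewrite -!pE => /val_inj/pI.
  apply/forallP=> x; apply/forallP=> y; rewrite -!pE -adj_pull.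
  by have /forallP/(_ y) := forallP pA x.
have fS x : f x \in f @: [set: V] by rewrite imset_f ?inE.
exists [ffun x => exist (fun y => y \in f @: [set: V]) (f x) (fS x)].
apply/andP; split; last by apply/forallP=> x; rewrite ffunE.
apply/and3P; split.
- by apply/injectiveP=> x y; rewrite !ffunE => -[] /fI.
- apply/forallP=> -[y yS]; have /imsetP[x _ e] := yS.
  by apply/existsP; exists x; rewrite ffunE -val_eqE /= e.
- apply/forallP=> x; apply/forallP=> y; rewrite !ffunE adj_pull /=.
  by have /forallP/(_ y) := forallP fA x.
Qed.

(* Main.v *)
(* Each of the six structures is the image of (hom, hom') under a linear bijection
   that fixes the connected graphs and respects product, coproduct, unit and counit;
   the Hopf axioms, freeness and uniqueness of the antipode are transported along it.

   For mono and regmono, let n_s(t) count the (regular) monomorphisms s -> t.  A pair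
   of embeddings of s1 and s2 in t factors uniquely through its image, so
   n_(s1 . s2) = n_s1 * n_s2, and n is faithful, being triangular for the number of
   vertices plus edges.  The bijection sends c to the element whose counting function is
   N_c, where N_c(t) counts the homomorphisms c -> t that are (regular) monomorphisms on
   each connected component of c: N is multiplicative for disjoint unions and equals n
   on connected graphs.  It is triangular for the number of non-adjacent pairs of
   vertices, which decreases along non-bijective epimorphisms.  It respects the coproduct
   because n_x(t1 + t2) is the evaluation of the coproduct of x at (t1, t2).

   The primed products are obtained from the unprimed ones by rescaling each class c by
   |Aut c|; rescaling c back by the product of the |Aut| of its components, which is an
   automorphism of (hom, hom'), restores the generators. *)
From HB Require Import structures.
Require Import Defs.
From mathcomp Require Import all_boot all_algebra.
From mathcomp Require Import finmap boolp monalg ring.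

Set Implicit Arguments.
Unset Strict Implicit.
Unset Printing Implicit Defensive.

Import GRing.Theory Num.Theory.
Local Open Scope ring_scope.

(** * Linear maps and tensors of free modules *)

Lemma lin_ext (K : choiceType) (U : lmodType rat) (f g : freeQ K -> U) :
  linear f -> linear g -> (forall k, f << k >> = g << k >>) -> f =1 g.
Proof.
move=> fL gL fg x; rewrite (lin_lext fL) (lin_lext gL).
by apply: eq_bigr => k _; rewrite fg.
Qed.

Lemma lin_comp (U V W : lmodType rat) (f : U -> V) (g : W -> U) :
  linear f -> linear g -> linear (fun x => f (g x)).
Proof. by move=> fL gL a x y; rewrite gL fL. Qed.

Lemma lin_lextK (K : choiceType) (U V : lmodType rat) (f : U -> V) (F : K -> U) x :
  linear f -> f (lext F x) = lext (fun k => f (F k)) x.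
Proof.
move=> fL; apply: (@lin_ext _ _ (fun x => f (lext F x))).
- by apply: lin_comp fL _; apply: lext_linear.
- exact: lext_linear.
- by move=> k; rewrite !lextU.
Qed.

Lemma lin_can (U V : lmodType rat) (f : U -> V) g : linear f -> cancel f g -> cancel g f -> linear g.
Proof.
by move=> fL fK gK a x y; rewrite -{1}(gK x) -{1}(gK y) -fL fK.
Qed.

Lemma lin_sum (U V : lmodType rat) (f : U -> V) (I : Type) (r : seq I) (P : pred I) F :
  linear f -> f (\sum_(i <- r | P i) F i) = \sum_(i <- r | P i) f (F i).
Proof.
move=> fL; pose h := HB.pack_for {linear U -> V} f
  (GRing.isLinear.Build _ _ _ _ f fL).
by rewrite -[f]/(h : _ -> _) linear_sum.
Qed.

Lemma linZ (U V : lmodType rat) (f : U -> V) a x : linear f -> f (a *: x) = a *: f x.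
Proof.
move=> fL; have f0 : f 0 = 0.
  by have := fL (-1) 0 0; rewrite scaler0 addr0 scaleN1r addNr.
by have := fL a x 0; rewrite f0 !addr0.
Qed.

Lemma eq_lext (K : choiceType) (U : lmodType rat) (F G : K -> U) : F =1 G -> lext F =1 lext G.
Proof. by move=> FG x; apply: eq_bigr => k _; rewrite FG. Qed.

Lemma lin_ext2 (K L : choiceType) (U : lmodType rat)
    (f g : freeQ K -> freeQ L -> U) :
  (forall y, linear (f ^~ y)) -> (forall x, linear (f x)) ->
  (forall y, linear (g ^~ y)) -> (forall x, linear (g x)) ->
  (forall k l, f << k >> << l >> = g << k >> << l >>) -> forall x y, f x y = g x y.
Proof.
move=> fl fr gl gr fg x y; apply: (lin_ext (fl y) (gl y)) => k.
by apply: (lin_ext (fr _) (gr _)).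
Qed.

Lemma lext_coeff (K L : choiceType) (F : K -> freeQ L) x c :
  (lext F x)@_c = lext (fun k => (F k)@_c : rat^o) x.
Proof. exact: (lin_lextK (V := rat^o) F x (mcoeffs_linear c)). Qed.

Lemma lext_coeff_deltaE (K : choiceType) (w : K -> rat) x c :
  (lext (fun k => w k *: << k >>) x)@_c = w c * x@_c.
Proof.
rewrite lext_coeff; apply: (@lin_ext K rat^o _ (fun x => w c * x@_c)) => [||k].
- exact: lext_linear.
- by move=> a u v; rewrite mcoeffD mcoeffZ mulrDr !scalerAr.
- rewrite lextU mcoeffZ !mcoeffU; case: eqP => [->//|_]; by rewrite !mulr0.
Qed.

Lemma lin_tensl (K L : choiceType) (U : lmodType rat) (f : U -> freeQ K) (y : freeQ L) :
  linear f -> linear (fun x => tens (f x) y).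
Proof. by move=> fL a u v; rewrite fL; have [/(_ y) H _] := lext2_bilin (fun (k : K) (l : L) => << (k, l) >> : freeQ (K * L)%type); apply: H. Qed.

Lemma lin_tensr (K L : choiceType) (U : lmodType rat) (x : freeQ K) (g : U -> freeQ L) :
  linear g -> linear (fun y => tens x (g y)).
Proof. by move=> gL a u v; rewrite gL; have [_ /(_ x) H] := lext2_bilin (fun (k : K) (l : L) => << (k, l) >> : freeQ (K * L)%type); apply: H. Qed.

Lemma lext_tens (K L : choiceType) (U : lmodType rat) (B : freeQ K -> freeQ L -> U) x y :
  (forall y, linear (B ^~ y)) -> (forall x, linear (B x)) ->
  lext (fun p => B << p.1 >> << p.2 >>) (tens x y) = B x y.
Proof.
move=> Bl Br; move: x y; apply: lin_ext2 => // [y|x|k l].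
- by apply: lin_comp; [apply: lext_linear | apply: lin_tensl].
- by apply: lin_comp; [apply: lext_linear | apply: lin_tensr].
- by rewrite tensU lextU.
Qed.

(** The coassociativity, counit and antipode identities all apply a bilinear [B] to a coproduct.
    This lemma moves a pair of linear maps from the tensor into the two arguments of [B], which is
    how these identities are transported and iterated. *)
Lemma lext_tens_map (K K' L L' : choiceType) (U : lmodType rat) (f : freeQ K' -> freeQ K)
    (g : freeQ L' -> freeQ L) (B : freeQ K -> freeQ L -> U) z :
  (forall y, linear (B ^~ y)) -> (forall x, linear (B x)) ->
  lext (fun p => B << p.1 >> << p.2 >>) (tens_map f g z) =
  lext (fun p => B (f << p.1 >>) (g << p.2 >>)) z.
Proof.
move=> Bl Br; rewrite lin_lextK; last exact: lext_linear.
by apply: eq_lext => p; rewrite lext_tens.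
Qed.

Lemma tens_map_tens (K K' L L' : choiceType) (f : freeQ K -> freeQ K') (g : freeQ L -> freeQ L') x y :
  linear f -> linear g -> tens_map f g (tens x y) = tens (f x) (g y).
Proof.
move=> fL gL; apply: (lext_tens (B := fun x y => tens (f x) (g y))).
- by move=> z; apply: lin_tensl.
- by move=> z; apply: lin_tensr.
Qed.

Lemma tens_map_comp (K K' K2 L L' L2 : choiceType)
    (f : freeQ K' -> freeQ K) (g : freeQ L' -> freeQ L)
    (f' : freeQ K -> freeQ K2) (g' : freeQ L -> freeQ L2) z :
  linear f' -> linear g' ->
  tens_map f' g' (tens_map f g z) = tens_map (fun x => f' (f x)) (fun y => g' (g y)) z.
Proof.
move=> fL gL; apply: (@lext_tens_map _ _ _ _ _ f g (fun x y => tens (f' x) (g' y))).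
- by move=> y; apply: lin_tensl.
- by move=> x; apply: lin_tensr.
Qed.

Lemma eq_tens_map (K K' L L' : choiceType) (f f' : freeQ K -> freeQ K')
    (g g' : freeQ L -> freeQ L') : f =1 f' -> g =1 g' -> tens_map f g =1 tens_map f' g'.
Proof. by move=> ff gg z; apply: eq_lext => p; rewrite ff gg. Qed.

Lemma tens_map_id (K L : choiceType) (z : freeQ (K * L)%type) :
  tens_map id id z = z.
Proof.
rewrite [RHS]Defs.freeE; apply: eq_lext => -[k l]; exact: tensU.
Qed.

Lemma lin_id (U : lmodType rat) : linear (id : U -> U).
Proof. by []. Qed.

Lemma tens_mapU (K K' L L' : choiceType) (f : freeQ K -> freeQ K')
    (g : freeQ L -> freeQ L') k l :
  tens_map f g << (k, l) >> = tens (f << k >>) (g << l >>).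
Proof. exact: lextU. Qed.

Lemma tens_assocU (K : choiceType) (a b c : K) :
  tens_assoc << ((a, b), c) >> = << (a, (b, c)) >>.
Proof. exact: lextU. Qed.

Lemma tens_map_linear (K K' L L' : choiceType) (f : freeQ K -> freeQ K')
    (g : freeQ L -> freeQ L') : linear (tens_map f g).
Proof. exact: lext_linear. Qed.

Lemma tens_assoc_linear (K : choiceType) : linear (@tens_assoc K).
Proof. exact: lext_linear. Qed.

Lemma tens_assoc_tens (K : choiceType) (x y z : freeQ K) :
  tens_assoc (tens (tens x y) z) = tens x (tens y z).
Proof.
move: x y; apply: lin_ext2.
- by move=> y; apply: lin_comp (@tens_assoc_linear K) (lin_tensl _ (lin_tensl _ (@lin_id _))).
- by move=> x; apply: lin_comp (@tens_assoc_linear K) (lin_tensl _ (lin_tensr _ (@lin_id _))).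
- by move=> y; apply: lin_tensl (@lin_id _).
- by move=> x; apply: lin_tensr; apply: lin_tensl (@lin_id _).
move=> k l; move: z; apply: lin_ext.
- by apply: lin_comp (@tens_assoc_linear K) (lin_tensr _ (@lin_id _)).
- by apply: lin_tensr; apply: lin_tensr (@lin_id _).
by move=> m; rewrite !tensU tens_assocU.
Qed.

Lemma tens_assoc_map (K L : choiceType) (f : freeQ K -> freeQ L) z : linear f ->
  tens_assoc (tens_map (tens_map f f) f z) = tens_map f (tens_map f f) (tens_assoc z).
Proof.
move=> fL; move: z; apply: lin_ext.
- exact: lin_comp (@tens_assoc_linear L) (@tens_map_linear _ _ _ _ _ _).
- exact: lin_comp (@tens_map_linear _ _ _ _ _ _) (@tens_assoc_linear K).
by move=> [[a b] c]; rewrite tens_assocU !tens_mapU tens_assoc_tens.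
Qed.

(** * Equivalences of Hopf data and their action on tensor squares *)

Section HopfEquiv.
Variables (K L : choiceType) (H : hopf_data K) (H' : hopf_data L).

(** Compatibility with antipodes is recovered from their uniqueness in [hopf_equiv_isomorphism]. *)
Definition hopf_equiv (f : freeQ K -> freeQ L) : Prop :=
  [/\ algebra_morphism H H' f, bijective f,
      forall x, hcop H' (f x) = tens_map f f (hcop H x)
    & forall x, heps H' (f x) = heps H x].

Lemma tens_mul_tens (M : choiceType) (A : algebra M) (a b c d : freeQ M) :
  is_algebra A ->
  amul (tens_algebra A) (tens a b) (tens c d) = tens (amul A a c) (amul A b d).
Proof.
move=> [mL mR _ _ _].
have [tL tR] := lext2_bilin (fun p q : M * M =>
  tens (amul A << p.1 >> << q.1 >>) (amul A << p.2 >> << q.2 >>)).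
move: a b; apply: lin_ext2.
- by move=> b; apply: (lin_comp (tL _)); apply: lin_tensl (@lin_id _).
- by move=> a; apply: (lin_comp (tL _)); apply: lin_tensr (@lin_id _).
- by move=> b; apply: lin_tensl.
- by move=> a; apply: lin_tensr.
move=> k l; move: c d; apply: lin_ext2.
- by move=> b; apply: (lin_comp (tR _)); apply: lin_tensl (@lin_id _).
- by move=> a; apply: (lin_comp (tR _)); apply: lin_tensr (@lin_id _).
- by move=> b; apply: lin_tensl.
- by move=> a; apply: lin_tensr.
by move=> c d; rewrite !tensU; apply: lext2U.
Qed.

Lemma tens_mul_bilin (M : choiceType) (A : algebra M) :
  (forall y, linear (amul (tens_algebra A) ^~ y)) /\
  (forall x, linear (amul (tens_algebra A) x)).
Proof. exact: lext2_bilin. Qed.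

Lemma algebra_transport f : is_algebra H -> algebra_morphism H H' f -> bijective f ->
  is_algebra H'.
Proof.
move=> [mL mR mA m1 m1'] [fL f1 fM] [g fK gK]; have gL := lin_can fL fK gK.
have M' x y : amul H' x y = f (amul H (g x) (g y)) by rewrite fM !gK.
split.
- by move=> y a u v; rewrite !M' gL mL fL.
- by move=> y a u v; rewrite !M' gL mR fL.
- by move=> x y z; rewrite !M' !fK mA.
- by move=> x; rewrite M' -f1 fK m1 gK.
- by move=> x; rewrite M' -f1 fK m1' gK.
Qed.

Lemma comm_algebra_transport f : is_comm_algebra H -> algebra_morphism H H' f ->
  bijective f -> is_comm_algebra H'.
Proof.
move=> [HA HC] fM fB; split; first exact: algebra_transport fB.
have [fL f1 fMu] := fM; have [g fK gK] := fB.
by move=> x y; rewrite -(gK x) -(gK y) -!fMu HC.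
Qed.

Lemma tens_map_mul f z w : is_algebra H -> is_algebra H' -> algebra_morphism H H' f ->
  tens_map f f (amul (tens_algebra H) z w) =
  amul (tens_algebra H') (tens_map f f z) (tens_map f f w).
Proof.
move=> AH AH' [fL f1 fM].
have [tL tR] := tens_mul_bilin H; have [tL' tR'] := tens_mul_bilin H'.
have mL := @tens_map_linear _ _ _ _ f f.
move: z w; apply: lin_ext2.
- by move=> y; apply: lin_comp mL (tL _).
- by move=> y; apply: lin_comp mL (tR _).
- by move=> y; apply: lin_comp (tL' _) mL.
- by move=> y; apply: lin_comp (tR' _) mL.
move=> [a b] [c d]; rewrite -(tensU a b) -(tensU c d).
rewrite (tens_mul_tens << a >> << b >> << c >> << d >> AH).
apply: etrans (tens_map_tens _ _ fL fL) _; rewrite (fM << a >>) (fM << b >>).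
apply: etrans (esym (tens_mul_tens _ _ _ _ AH')) _.
exact: congr2 (esym (tens_map_tens _ _ fL fL)) (esym (tens_map_tens _ _ fL fL)).
Qed.

End HopfEquiv.

(** * Convolution and transport of Hopf structures *)

Section Convolution.
Variables (K : choiceType) (H : hopf_data K).

(** The convolution product of endomorphisms. Its unit is [fun y => heps H y *: aone H], and an
    antipode is a two-sided inverse of the identity. *)
Definition conv (F G : freeQ K -> freeQ K) (x : freeQ K) : freeQ K :=
  lext (fun p : K * K => amul H (F << p.1 >>) (G << p.2 >>)) (hcop H x).

Hypothesis HB : is_bialgebra H.

Lemma conv_assoc F G I x : linear F -> linear G -> linear I ->
  conv F (conv G I) x = conv (conv F G) I x.
Proof.
move=> FL GL IL; have [[mL mR mA _ _] [cL _ cA _ _] _ _] := HB.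
pose m2 (F G : freeQ K -> freeQ K) :=
  lext (fun p : K * K => amul H (F << p.1 >>) (G << p.2 >>)).
have m2L F' G' : linear (m2 F' G') by exact: lext_linear.
pose B u v := amul H (F u) (m2 G I v).
pose B' u v := amul H (m2 F G u) (I v).
have Bl v : linear (B ^~ v) by apply: lin_comp (mL _) FL.
have Br u : linear (B u) by apply: lin_comp (mR _) (m2L _ _).
have Bl' v : linear (B' ^~ v) by apply: lin_comp (mL _) (m2L _ _).
have Br' u : linear (B' u) by apply: lin_comp (mR _) IL.
(* The two nested convolutions are bilinear forms of [id] tensor [hcop H] and of [hcop H] tensor
   [id] applied to the coproduct. Coassociativity identifies these tensors, and associativity of the
   product then identifies the forms. *)
have E := @lext_tens_map _ _ _ _ _ id (hcop H) B (hcop H x) Bl Br.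
have E' := @lext_tens_map _ _ _ _ _ (hcop H) id B' (hcop H x) Bl' Br'.
apply: etrans (esym E) (etrans _ E').
rewrite -cA lin_lextK; last exact: lext_linear.
apply: eq_lext => -[[a b] c]; rewrite lextU /B /B' /m2 !lextU /=.
exact: mA.
Qed.

Lemma conv_eps_l F x : linear F ->
  conv (fun y => heps H y *: aone H) F x = F x.
Proof.
move=> FL; have [[mL mR mA m1 _] [cL _ _ c1 _] _ _] := HB.
rewrite -[in RHS](c1 x) lin_lextK //; apply: eq_lext => p.
by rewrite (linZ _ _ (mL _)) m1 (linZ _ _ FL).
Qed.

Lemma conv_eps_r F x : linear F ->
  conv F (fun y => heps H y *: aone H) x = F x.
Proof.
move=> FL; have [[mL mR mA _ m1] [cL _ _ _ c1] _ _] := HB.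
rewrite -[in RHS](c1 x) lin_lextK //; apply: eq_lext => p.
by rewrite (linZ _ _ (mR _)) m1 (linZ _ _ FL).
Qed.

Lemma eq_conv F F' G G' x : F =1 F' -> G =1 G' -> conv F G x = conv F' G' x.
Proof. by move=> FF GG; apply: eq_lext => p; rewrite FF GG. Qed.

(** Inverses in a monoid are unique: with [*] for convolution,
    [S = (S' * id) * S = S' * (id * S) = S']. *)
Lemma antipode_uniq S S' : is_antipode H S -> is_antipode H S' -> S =1 S'.
Proof.
move=> [SL _ Sr] [SL' Sl' _] x.
rewrite -[LHS](conv_eps_l _ SL) -[RHS](conv_eps_r _ SL').
have e1 : (fun y => heps H y *: aone H) =1 conv S' id by move=> y; rewrite -Sl'.
have e2 : (fun y => heps H y *: aone H) =1 conv id S by move=> y; rewrite -Sr.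
rewrite (eq_conv _ e1 (frefl S)) (eq_conv _ (frefl S') e2).
by rewrite conv_assoc //; apply: lin_id.
Qed.

End Convolution.

Section HopfTransport.
Variables (K L : choiceType) (H : hopf_data K) (H' : hopf_data L).
Variable f : freeQ K -> freeQ L.
Hypothesis fE : hopf_equiv H H' f.

Lemma coalgebra_transport : is_coalgebra H -> is_coalgebra H'.
Proof.
move=> [cL eL cA cl cr]; have [[fL _ _] [g fK gK] fC fe] := fE.
have gL := lin_can fL fK gK.
have C' x : hcop H' x = tens_map f f (hcop H (g x)) by rewrite -fC gK.
have e' x : heps H' x = heps H (g x) by rewrite -fe gK.
have C'L : linear (hcop H').
  by move=> a u v; rewrite !C' gL cL; apply: tens_map_linear.
have e'L : linear (heps H' : freeQ L -> rat^o).
  by move=> a u v; rewrite !e' gL eL.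
split=> // x; rewrite -{1 2}(gK x).
- have fTL := @tens_map_linear _ _ _ _ f f.
  (* Both iterated coproducts of [f (g x)] become images under the triple tensor power of [f] of
     those of [g x], where [cA] applies. *)
  rewrite fC (tens_map_comp _ _ _ C'L (@lin_id _)).
  rewrite (eq_tens_map fC (frefl (fun y => f y))).
  rewrite -(tens_map_comp (hcop H) id _ fTL fL).
  apply: etrans (tens_assoc_map _ fL) _; rewrite cA.
  rewrite (tens_map_comp _ _ _ fL fTL) (tens_map_comp _ _ _ (@lin_id _) C'L).
  exact: eq_tens_map (frefl _) (fsym fC) _.
- rewrite fC (@lext_tens_map _ _ _ _ _ f f (fun u v => heps H' u *: v)) //; last 2 first.
  + by move=> v a u w; rewrite e'L scalerDl -scalerA.
  + by move=> u a v w; rewrite scalerDr !scalerA mulrC.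
  rewrite -[in RHS](cl (g x)) lin_lextK //; apply: eq_lext => p.
  by rewrite fe (linZ _ _ fL).
- rewrite fC (@lext_tens_map _ _ _ _ _ f f (fun u v => heps H' v *: u)) //; last 2 first.
  + by move=> u a v w; rewrite scalerDr !scalerA mulrC.
  + by move=> v a u w; rewrite e'L scalerDl -scalerA.
  rewrite -[in RHS](cr (g x)) lin_lextK //; apply: eq_lext => p.
  by rewrite fe (linZ _ _ fL).
Qed.

Lemma bialgebra_transport : is_bialgebra H -> is_bialgebra H'.
Proof.
move=> [HA HC [c1 cM] [e1 eM]]; have [fM fB fC fe] := fE.
have HA' := algebra_transport HA fM fB.
split; [exact: HA' | exact: coalgebra_transport | split | split].
- have [fL f1 _] := fM; rewrite -f1 fC c1.
  by apply: etrans (tens_map_tens _ _ fL fL) _; rewrite f1.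
- have [g fK gK] := fB; have [fL f1 fMu] := fM.
  move=> x y; rewrite -(gK x) -(gK y) -fMu !fC cM.
  exact: tens_map_mul.
- by have [fL <- _] := fM; rewrite fe.
- have [g fK gK] := fB; have [fL f1 fMu] := fM.
  by move=> x y; rewrite -(gK x) -(gK y) -fMu !fe.
Qed.

Lemma antipode_transport S g : is_algebra H -> cancel f g -> cancel g f ->
  is_antipode H S -> is_antipode H' (fun x => f (S (g x))).
Proof.
move=> HA fK gK [SL Sl Sr]; have [[fL f1 fM] fB fC fe] := fE.
have gL := lin_can fL fK gK.
have [mL' mR' _ _ _] := algebra_transport HA (And3 fL f1 fM) fB.
have S'L : linear (fun x => f (S (g x))) by apply: lin_comp fL (lin_comp SL gL).
split=> // x; rewrite -{1 2}(gK x).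
- rewrite fC fe (@lext_tens_map _ _ _ _ _ f f (fun u v => amul H' (f (S (g u))) v)).
  + by rewrite -f1 -(linZ _ _ fL) -Sl lin_lextK //; apply: eq_lext => p; rewrite fK fM.
  + by move=> y; apply: lin_comp (mL' _) S'L.
  + by move=> y; apply: mR'.
- rewrite fC fe (@lext_tens_map _ _ _ _ _ f f (fun u v => amul H' u (f (S (g v))))).
  + by rewrite -f1 -(linZ _ _ fL) -Sr lin_lextK //; apply: eq_lext => p; rewrite fK fM.
  + by move=> y; apply: mL'.
  + by move=> y; apply: lin_comp (mR' _) S'L.
Qed.

Lemma hopf_transport : is_hopf H -> is_hopf H'.
Proof.
move=> [HB [S HS]]; split; first exact: bialgebra_transport.
have [_ [g fK gK] _ _] := fE; have [HA _ _ _] := HB.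
by exists (fun x => f (S (g x))); apply: antipode_transport.
Qed.

(** Conjugating an antipode of [H] by [f] gives an antipode of [H'], which by uniqueness is the
    given one. *)
Lemma hopf_equiv_isomorphism : is_hopf H -> hopf_isomorphism H H' f.
Proof.
move=> HH; have [HB _] := HH; have [fM fB fC fe] := fE; split=> //; split=> //.
move=> S S' HS HS' x; have [g fK gK] := fB; have [HA _ _ _] := HB.
rewrite -{1}(fK x).
exact: (antipode_uniq (bialgebra_transport HB) (antipode_transport HA fK gK HS) HS').
Qed.

Lemma freely_generated_transport (I : Type) (x : I -> freeQ K) (y : I -> freeQ L) :
  (forall i, f (x i) = y i) -> freely_generated H x -> freely_generated H' y.
Proof.
move=> fxy [HC HF]; have [[fL f1 fM] fB _ _] := fE.
split; first exact: comm_algebra_transport HC (And3 fL f1 fM) fB.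
have [g fK gK] := fB; have gL := lin_can fL fK gK.
move=> B b; have [h [hL h1 hM hx] hU] := HF B b.
exists (fun u => h (g u)).
  split.
  - exact: lin_comp hL gL.
  - by rewrite -f1 fK.
  - by move=> u v; rewrite -{1}(gK u) -{1}(gK v) -fM fK hM.
  - by move=> i; rewrite -fxy fK.
move=> h' [h'L h'1 h'M h'x] u; rewrite -{1}(gK u).
apply: (hU (fun v => h' (f v))); split.
- exact: lin_comp h'L fL.
- by rewrite f1.
- by move=> v w; rewrite fM h'M.
- by move=> i; rewrite fxy.
Qed.

End HopfTransport.

Lemma hopf_equiv_comp (K L M : choiceType) (H : hopf_data K) (H' : hopf_data L)
    (H'' : hopf_data M) f f' :
  hopf_equiv H H' f -> hopf_equiv H' H'' f' -> hopf_equiv H H'' (fun x => f' (f x)).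
Proof.
move=> [[fL f1 fM] fB fC fe] [[fL' f1' fM'] fB' fC' fe']; split.
- split; first exact: lin_comp.
    by rewrite f1 f1'.
  by move=> x y; rewrite fM fM'.
- exact: bij_comp fB' fB.
- by move=> x; rewrite fC' fC tens_map_comp.
- by move=> x; rewrite fe' fe.
Qed.

(** * Disjoint union, connected components and multiplicative functions *)

Definition gadd (s t : gclass) : gclass := class_of (gunion (rep s) (rep t)).

Lemma gadd_class (V W : finType) (g : graph V) (h : graph W) :
  gadd (class_of g) (class_of h) = class_of (gunion g h).
Proof. exact: class_of_union. Qed.

Lemma gaddC : commutative gadd.
Proof.
move=> s t; apply/class_ofP; pose F V W (z : V + W) : W + V :=
  match z with inl x => inr x | inr y => inl y end.
apply: (@is_isoI _ _ _ _ (@F _ _)).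
- by case=> x [] y //= [] ->.
- by case=> y; [exists (inr y) | exists (inl y)].
- by case=> x [] y; rewrite !adj_graph_of.
Qed.

Lemma gaddA : associative gadd.
Proof.
move=> s t u; rewrite -{1}(class_of_rep s) -{2}(class_of_rep u) !gadd_class.
apply/class_ofP; pose F U V W (z : U + (V + W)) : U + V + W :=
  match z with inl x => inl (inl x) | inr (inl y) => inl (inr y)
  | inr (inr y) => inr y end.
apply: (@is_isoI _ _ _ _ (@F _ _ _)).
- by case=> [x|[x|x]] [y|[y|y]] //= [] ->.
- case=> [[]|] y; [by exists (inl y) | by exists (inr (inl y)) |].
  by exists (inr (inr y)).
- by case=> [x|[x|x]] [y|[y|y]]; rewrite !adj_graph_of /= ?adj_graph_of.
Qed.

Lemma gadd0g : left_id empty_class gadd.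
Proof.
move=> t; rewrite -[in LHS](class_of_rep t) gadd_class -[RHS]class_of_rep.
apply/class_ofP; rewrite iso_sym; apply: (@is_isoI _ _ _ _ inr).
- by move=> x y [].
- by case=> [[]|y] //; exists y.
- by move=> x y; rewrite adj_graph_of.
Qed.

Lemma gaddg0 : right_id empty_class gadd.
Proof. by move=> t; rewrite gaddC gadd0g. Qed.

Lemma gorder_gadd s t : gorder (gadd s t) = (gorder s + gorder t)%N.
Proof. by rewrite gorder_class_of card_sum !card_ord. Qed.

Lemma gorder_empty : gorder empty_class = 0%N.
Proof. by rewrite gorder_class_of card_ord. Qed.

Lemma gorder_eq0 c : (gorder c == 0%N) = (c == empty_class).
Proof.
apply/eqP/eqP => [c0|->]; last exact: gorder_empty.
by rewrite -(class_of_rep c); apply: empty_classE; rewrite card_ord.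
Qed.

Lemma gadd_eq0 s t : (gadd s t == empty_class) = (s == empty_class) && (t == empty_class).
Proof. by rewrite -!gorder_eq0 gorder_gadd addn_eq0. Qed.

(** Induction along disjoint unions. In a nonempty disconnected graph, the set of vertices reachable
    from a suitable vertex and its complement are both proper subsets that no edge leaves, so the
    graph is the union of two smaller ones. *)
Lemma gclass_ind (P : gclass -> Prop) :
  P empty_class -> (forall c, gconnected (rep c) -> P c) ->
  (forall s t, P s -> P t -> P (gadd s t)) -> forall c, P c.
Proof.
move=> P0 P1 PD c; have [n] := ubnP (gorder c); elim: n c => // n IHn c.
rewrite ltnS => cn.
have [cc|] := boolP (gconnected (rep c)); first exact: P1.
rewrite negb_and -leqNgt leqn0 card_ord gorder_eq0 => /orP[/eqP->//|].
case/forallPn=> x /forallPn[y xy].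
pose S := [set z | connect (adj (rep c)) x z].
have cS : splits (rep c) S.
  apply/splitsP=> u v uv; rewrite !inE; apply/idP/idP => [xu|xv].
    exact: connect_trans xu (connect1 uv).
  by apply: connect_trans xv (connect1 _); rewrite adj_sym.
have xS : x \in S by rewrite inE connect0.
have yS : y \notin S by rewrite inE.
have lt (T : {set 'I_(gorder c)}) z : z \notin T ->
    (gorder (class_of (induced (rep c) T)) < n)%N.
  move=> zT; rewrite gorder_class_of card_sig; apply: leq_trans cn.
  rewrite -[X in (_ < X)%N](card_ord (gorder c)); apply: proper_card.
  by apply/properP; split; [apply/fintype.subsetP | exists z].
rewrite -(class_of_rep c) (class_of_split cS) -gadd_class.
apply: PD; apply: IHn; first exact: lt yS.
by apply: (lt _ x); rewrite inE negbK.
Qed.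

Lemma splits_union (V W : finType) (g : graph V) (h : graph W) (S : {set V + W}) :
  splits (gunion g h) S = splits g (inl @^-1: S) && splits h (inr @^-1: S).
Proof.
apply/splitsP/andP => [H|[/splitsP HA /splitsP HB]].
  split; apply/splitsP=> x y xy.
    by have := H (inl x) (inl y); rewrite adj_graph_of !inE /=; apply.
  by have := H (inr x) (inr y); rewrite adj_graph_of !inE /=; apply.
case=> x [] y; rewrite adj_graph_of //= => xy.
  by have := HA _ _ xy; rewrite !inE.
by have := HB _ _ xy; rewrite !inE.
Qed.

Lemma splits0 (V : finType) (g : graph V) : splits g finset.set0.
Proof. by apply/splitsP=> x y; rewrite !inE. Qed.

Lemma splits_connected (V : finType) (g : graph V) (S : {set V}) : gconnected g ->
  splits g S = (S == [set: V]) || (S == finset.set0).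
Proof.
case/andP=> /card_gt0P[x0 _] /forallP gc.
have conn y : connect (adj g) x0 y by have /forallP := gc x0.
apply/idP/orP => [gS|[]/eqP->]; try by apply/splitsP=> x y _; rewrite !inE.
have [xS|xS] := boolP (x0 \in S); [left|right]; apply/eqP/setP=> y.
  by rewrite inE -(split_connect gS (conn y)).
by rewrite inE -(split_connect gS (conn y)) (negbTE xS).
Qed.

Section Components.

(** Connected components, encoded as the minimal nonempty sets that no edge leaves; in this form
    they are compared through preimages of sets under isomorphisms and under [inl] and [inr]. *)
Definition component (V : finType) (g : graph V) : pred {set V} :=
  minset (fun S => (S != finset.set0) && splits g S).

Lemma component_connected (V : finType) (g : graph V) (C : {set V}) :
  gconnected g -> component g C = (C == [set: V]).
Proof.
move=> gc; apply/minsetP/eqP => [[/andP[C0]]|->].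
  by rewrite splits_connected // (negbTE C0) orbF => /eqP.
have T0 : [set: V] != finset.set0.
  by case/andP: gc => /card_gt0P[x _] _; apply/set0Pn; exists x.
split=> [|B]; first by rewrite T0 splits_connected // eqxx.
by rewrite splits_connected // => /andP[/negbTE->]; rewrite orbF => /eqP.
Qed.

Lemma component_iso (V W : finType) (g : graph V) (h : graph W) f f' (T : {set W}) :
  cancel f f' -> cancel f' f -> (forall x y, adj g x y = adj h (f x) (f y)) ->
  component g (f @^-1: T) = component h T.
Proof.
move=> fK f'K fA.
have f'A x y : adj h x y = adj g (f' x) (f' y) by rewrite fA !f'K.
have pre (U U' : finType) (k : graph U) (k' : graph U') e e' (S : {set U'}) :
    cancel e e' -> cancel e' e -> (forall x y, adj k x y = adj k' (e x) (e y)) ->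
    (S != finset.set0) && splits k' S -> (e @^-1: S != finset.set0) && splits k (e @^-1: S).
  move=> eK e'K eA /andP[/set0Pn[x xS] /splitsP kS]; apply/andP; split.
    by apply/set0Pn; exists (e' x); rewrite inE e'K.
  by apply/splitsP=> u v; rewrite eA !inE; apply: kS.
have imp (U U' : finType) (k : graph U) (k' : graph U') e e' (S : {set U'}) :
    cancel e e' -> cancel e' e -> (forall x y, adj k x y = adj k' (e x) (e y)) ->
    component k' S -> component k (e @^-1: S).
  move=> eK e'K eA /minsetP[kS mS]; apply/minsetP; split; first exact: pre kS.
  move=> B kB BS.
  have B' : e' @^-1: B = S.
    apply: mS; first by apply: pre kB => // x y; rewrite eA !e'K.
    apply/fintype.subsetP=> x; rewrite inE => /(fintype.subsetP BS).
    by rewrite inE e'K.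
  by rewrite -B'; apply/setP=> x; rewrite !inE eK.
apply/idP/idP; last exact: imp.
move/(imp _ _ h g f' f _ f'K fK f'A); congr component.
by apply/setP=> x; rewrite !inE f'K.
Qed.

Lemma component_inl (V W : finType) (g : graph V) (h : graph W) (S : {set V + W}) :
  inr @^-1: S = finset.set0 ->
  component (gunion g h) S = component g (inl @^-1: S).
Proof.
move=> rS; have rT (T : {set V + W}) : T \subset S -> inr @^-1: T = finset.set0.
  move=> TS; apply/setP=> x; rewrite !inE; apply/negP=> /(fintype.subsetP TS) xS.
  by have := in_set0 x; rewrite -rS inE xS.
have nz (T : {set V + W}) : inr @^-1: T = finset.set0 ->
    (T != finset.set0) = (inl @^-1: T != finset.set0).
  move=> T0; apply/set0Pn/set0Pn => [[[x|x] xT]|[x]].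
  - by exists x; rewrite inE.
  - by have := in_set0 x; rewrite -T0 inE xT.
  - by rewrite inE; exists (inl x).
have lK (T : {set V + W}) : inr @^-1: T = finset.set0 -> inl @: (inl @^-1: T) = T.
  move=> T0; apply/setP=> -[x|x]; first by rewrite mem_imset ?inE //; apply: inl_inj.
  have := in_set0 x; rewrite -T0 inE => ->; by apply/imsetP=> -[].
have lK' (C : {set V}) : inl @^-1: (inl @: C : {set V + W}) = C.
  by apply/setP=> x; rewrite inE mem_imset //; apply: inl_inj.
have r0 (C : {set V}) : inr @^-1: (inl @: C : {set V + W}) = finset.set0.
  by apply/setP=> x; rewrite !inE; apply/imsetP=> -[].
apply/minsetP/minsetP => -[].
  rewrite splits_union nz // rS splits0 andbT => kS mS; split=> // B kB BS.
  suff <- : inl @: B = S by rewrite lK'.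
  apply: mS; first by rewrite splits_union nz // r0 lK' splits0 andbT.
  by rewrite -(lK S rS); apply: imsetS.
move=> kS mS; split; first by rewrite splits_union nz // rS splits0 andbT.
move=> B; rewrite splits_union => /and3P[B0 kB _] BS.
rewrite -(lK _ (rT _ BS)) -[RHS](lK _ rS).
rewrite (mS (inl @^-1: B)) //.
  by rewrite -nz ?B0 ?kB //; apply: rT.
by apply/fintype.subsetP=> x; rewrite !inE; apply: (fintype.subsetP BS).
Qed.

Lemma component_inr (V W : finType) (g : graph V) (h : graph W) (S : {set V + W}) :
  inl @^-1: S = finset.set0 ->
  component (gunion g h) S = component h (inr @^-1: S).
Proof.
pose sw A B (z : A + B) : B + A := match z with inl x => inr x | inr y => inl y end.
have swK A B : cancel (@sw A B) (@sw B A) by case.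
move=> S0; transitivity (component (gunion h g) (@sw W V @^-1: S)).
  apply/esym/(component_iso _ (swK _ _) (swK _ _)) => -[x|x] [y|y];
  by rewrite !adj_graph_of.
have E1 : inr @^-1: (@sw W V @^-1: S) = inl @^-1: S by apply/setP=> x; rewrite !inE.
have E2 : inl @^-1: (@sw W V @^-1: S) = inr @^-1: S by apply/setP=> x; rewrite !inE.
by rewrite component_inl ?E1 ?E2.
Qed.

(** The part of [S] in the right summand is itself a nonempty set that no edge leaves, so by
    minimality it is all of [S]. *)
Lemma component_union (V W : finType) (g : graph V) (h : graph W) (S : {set V + W}) :
  component (gunion g h) S ->
  inr @^-1: S != finset.set0 -> inl @^-1: S = finset.set0.
Proof.
move=> /minsetP[/andP[S0 kS] mS] /set0Pn[x]; rewrite inE => xS.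
have E : inr @: (inr @^-1: S) = S.
  apply: mS; last by apply/fintype.subsetP=> _ /imsetP[y + ->]; rewrite inE.
  apply/andP; split.
    by apply/set0Pn; exists (inr x); rewrite mem_imset ?inE //; apply: inr_inj.
  move: kS; rewrite !splits_union => /andP[_].
  have -> : inr @^-1: (inr @: (inr @^-1: S) : {set V + W}) = inr @^-1: S.
    by apply/setP=> y; rewrite inE mem_imset //; apply: inr_inj.
  have -> : inl @^-1: (inr @: (inr @^-1: S) : {set V + W}) = finset.set0.
    by apply/setP=> y; rewrite !inE; apply/imsetP=> -[].
  by rewrite splits0.
by apply/setP=> y; rewrite !inE -E; apply/imsetP=> -[].
Qed.

Variables (B : comPzRingType) (b : gclass -> B).

(** The extension of [b] from connected graphs to a function multiplicative for disjoint union. It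
    serves for the universal property, for the sign of the antipode and for the weight that restores
    the generators. *)
Definition chi_graph (V : finType) (g : graph V) : B :=
  \prod_(C : {set V} | component g C) b (class_of (induced g C)).

Lemma chi_graph_iso (V W : finType) (g : graph V) (h : graph W) :
  iso_exists g h -> chi_graph g = chi_graph h.
Proof.
case/iso_existsP=> f [f' fK f'K] fA; have fB : bijective f by exists f'.
rewrite /chi_graph (reindex (fun T : {set W} => f @^-1: T)); last first.
  exists (fun S : {set V} => f' @^-1: S) => S _; apply/setP=> x.
    by rewrite !inE f'K.
  by rewrite !inE fK.
apply: eq_big => [T|T _]; first exact: component_iso f'K _.
by congr b; apply/class_ofP; apply: (iso_induced fB fA) => x; rewrite inE.
Qed.

(** Each component of the union lies in one of the summands, and the product is split
    accordingly. *)
Lemma chi_graph_union (V W : finType) (g : graph V) (h : graph W) :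
  chi_graph (gunion g h) = chi_graph g * chi_graph h.
Proof.
have lK' (C : {set V}) : inl @^-1: (inl @: C : {set V + W}) = C.
  by apply/setP=> x; rewrite inE mem_imset //; apply: inl_inj.
have r0 (C : {set V}) : inr @^-1: (inl @: C : {set V + W}) = finset.set0.
  by apply/setP=> x; rewrite !inE; apply/imsetP=> -[].
have rK' (C : {set W}) : inr @^-1: (inr @: C : {set V + W}) = C.
  by apply/setP=> x; rewrite inE mem_imset //; apply: inr_inj.
have l0 (C : {set W}) : inl @^-1: (inr @: C : {set V + W}) = finset.set0.
  by apply/setP=> x; rewrite !inE; apply/imsetP=> -[].
rewrite /chi_graph (bigID (fun S : {set V + W} => inr @^-1: S == finset.set0)) /=.
congr (_ * _).
  rewrite (reindex_onto (fun C : {set V} => inl @: C) (fun S => inl @^-1: S)) /=.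
    apply: eq_big => [C|C _]; first by rewrite component_inl ?r0 // lK' !eqxx !andbT.
    congr b; rewrite induced_union lK' r0 -gadd_class.
    rewrite [X in gadd _ X]induced_set0 ?gaddg0 // => x; by rewrite inE.
  move=> S /andP[_ /eqP S0]; apply/setP=> -[x|x].
    by rewrite mem_imset ?inE //; apply: inl_inj.
  by have := in_set0 x; rewrite -S0 inE => ->; apply/imsetP=> -[].
rewrite (reindex_onto (fun C : {set W} => inr @: C) (fun S => inr @^-1: S)) /=.
  apply: eq_big => [C|C _].
    rewrite component_inr ?l0 // rK' eqxx andbT andb_idr // => /minsetP[].
    by case/andP.
  congr b; rewrite induced_union rK' l0 -gadd_class.
  rewrite [X in gadd X _]induced_set0 ?gadd0g // => x; by rewrite inE.
move=> S /andP[cS S0]; have S0' := component_union cS S0; apply/setP=> -[x|x].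
  by have := in_set0 x; rewrite -S0' inE => ->; apply/imsetP=> -[].
by rewrite mem_imset ?inE //; apply: inr_inj.
Qed.

Definition chi (c : gclass) : B := chi_graph (rep c).

Lemma chi_gadd s t : chi (gadd s t) = chi s * chi t.
Proof. by rewrite /chi (chi_graph_iso (rep_class_of _)) chi_graph_union. Qed.

Lemma chi0 : chi empty_class = 1.
Proof.
rewrite /chi (chi_graph_iso (rep_class_of _)) /chi_graph big_pred0 // => S.
apply/negP=> /minsetP[/andP[/set0Pn[[]]]] //.
Qed.

Lemma chi_connected c : gconnected (rep c) -> chi c = b c.
Proof.
move=> cc; rewrite /chi /chi_graph (big_pred1 [set: 'I_(gorder c)]).
  by rewrite induced_setT ?class_of_rep // => x; rewrite inE.
by move=> C; rewrite component_connected.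
Qed.

End Components.

(** * Counting maps into a disjoint union *)

Lemma card_bij (A B : finType) (X : {set A}) (Y : {set B}) (F : A -> B) :
  {in X &, injective F} -> (forall a, a \in X -> F a \in Y) ->
  (forall b, b \in Y -> exists2 a, a \in X & F a = b) -> #|X| = #|Y|.
Proof.
move=> FI FX FY; rewrite -(card_in_imset FI); apply: eq_card => y.
apply/imsetP/idP => [[x xX ->]|/FY[x xX <-]]; first exact: FX.
by exists x.
Qed.

Section Glue.
Variables (V W1 W2 : finType).
Implicit Type S : {set V}.

Definition unpart S (z : {x | x \in S} + {x | x \in ~: S}) : V :=
  match z with inl u => val u | inr v => val v end.

(** The inverse of [unpart]. The case analysis is on [decP] because the proof of membership is
    needed to build the element of the subtype. *)
Definition part S (x : V) : {x | x \in S} + {x | x \in ~: S} :=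
  match decP (@idP (x \in S)) with
  | left h => inl (exist _ x h)
  | right h => inr (exist _ x (introT setCP h))
  end.

Lemma partK S : cancel (@part S) (@unpart S).
Proof. by move=> x; rewrite /part; case: decP. Qed.

Lemma notin_setC S (v : {x | x \in ~: S}) : (val v \in S) = false.
Proof. by have := valP v; rewrite inE => /negbTE. Qed.

Lemma unpart_inj S : injective (@unpart S).
Proof.
case=> u [] v /= e; try by rewrite (val_inj e).
  by have := valP u; have := notin_setC v; rewrite /= -e => ->.
by have := valP v; have := notin_setC u; rewrite /= e => ->.
Qed.

Lemma unpartK S : cancel (@unpart S) (@part S).
Proof. by move=> z; apply: unpart_inj; rewrite partK. Qed.

Definition side (f : {ffun V -> W1 + W2}) : {set V} :=
  [set x | if f x is inl _ then true else false].

(** A map into a disjoint union amounts to the preimage [S] of the left summand, a map on [S] and a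
    map on its complement. *)
Definition glue S
    (p : {ffun {x | x \in S} -> W1} * {ffun {x | x \in ~: S} -> W2}) :
    {ffun V -> W1 + W2} :=
  [ffun x => match part S x with inl u => inl (p.1 u) | inr v => inr (p.2 v) end].

Lemma glue_unpart S p z : glue p (@unpart S z) =
  match z with inl u => inl (p.1 u) | inr v => inr (p.2 v) end.
Proof. by rewrite ffunE unpartK. Qed.

Lemma side_glue S p : side (@glue S p) = S.
Proof.
apply/setP=> x; rewrite inE -(partK S x) glue_unpart.
by case: (part S x) => u; rewrite /= ?notin_setC // (valP u).
Qed.

Lemma glue_inj S : injective (@glue S).
Proof.
move=> [f1 f2] [e1 e2] E; congr (_, _); apply/ffunP=> u.
  by have := glue_unpart (f1, f2) (inl u); rewrite E glue_unpart => -[].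
by have := glue_unpart (f1, f2) (inr u); rewrite E glue_unpart => -[].
Qed.

Lemma glue_surj (f : {ffun V -> W1 + W2}) : exists p, @glue (side f) p = f.
Proof.
have h1 (u : {x | x \in side f}) : exists w, f (val u) == inl w.
  by have := valP u; rewrite inE; case: (f _) => // w _; exists w.
have h2 (u : {x | x \in ~: side f}) : exists w, f (val u) == inr w.
  by have := notin_setC u; rewrite inE; case: (f _) => // w _; exists w.
exists ([ffun u => xchoose (h1 u)], [ffun u => xchoose (h2 u)]).
apply/ffunP=> x; rewrite -(partK (side f) x) glue_unpart.
case: (part _ x) => u; rewrite ffunE; apply/esym/eqP.
  exact: (xchooseP (h1 u)).
exact: (xchooseP (h2 u)).
Qed.

(** The maps are sorted by [side]; for each [S], [glue] is a bijection from pairs of maps to the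
    maps whose side is [S]. *)
Lemma card_glue (Q : pred {ffun V -> W1 + W2}) (R : pred {set V})
    (Q1 : forall S, pred {ffun {x | x \in S} -> W1})
    (Q2 : forall S, pred {ffun {x | x \in ~: S} -> W2}) :
  (forall S p, Q (@glue S p) = [&& R S, Q1 S p.1 & Q2 S p.2]) ->
  #|[set f | Q f]| = (\sum_(S | R S) #|[set f | Q1 S f]| * #|[set f | Q2 S f]|)%N.
Proof.
move=> QE; rewrite -sum1_card (partition_big side R) /=.
  apply: eq_bigr => S RS; rewrite sum1dep_card -cardsX; apply/esym.
  apply: (card_bij (F := @glue S)) => [p q _ _|p|f].
  - exact: glue_inj.
  - by rewrite !inE QE RS side_glue eqxx andbT.
  - rewrite !inE => /andP[Qf /eqP fS]; subst S; have [p pf] := glue_surj f.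
    by exists p => //; rewrite !inE; move: Qf; rewrite -{1}pf QE => /andP[].
move=> f; rewrite inE; have [p {1}<-] := glue_surj f.
by rewrite QE => /andP[].
Qed.

End Glue.

Section Cmor.

(* With D total these are the (regular, if reg) monomorphisms; with D relating
   the vertices of the same summand, the maps counted by M and R; with
   D := connect (adj g), the maps that embed each connected component. *)
Definition cmor (reg : bool) (V W : finType) (D : rel V) (g : graph V) (h : graph W)
    (f : {ffun V -> W}) :=
  is_hom g h f && [forall x, forall y, D x y ==>
    ((f x == f y) ==> (x == y)) && (reg ==> adj h (f x) (f y) ==> adj g x y)].

Definition full_rel (V : finType) : rel V := fun _ _ => true.

Lemma is_homP (V W : finType) (g : graph V) (h : graph W) (f : {ffun V -> W}) :
  reflect (forall x y, adj g x y -> adj h (f x) (f y)) (is_hom g h f).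
Proof.
apply: (iffP forallP) => [H x y|H x]; first by have /forallP/(_ y)/implyP := H x.
by apply/forallP=> y; apply/implyP/H.
Qed.

Lemma surjP (V W : finType) (f : {ffun V -> W}) :
  reflect (forall y, exists x, f x = y) [forall y, exists x, f x == y].
Proof.
apply: (iffP forallP) => H y; first by have /existsP[x /eqP <-] := H y; exists x.
by apply/existsP; have [x <-] := H y; exists x.
Qed.

Lemma cmorP (reg : bool) (V W : finType) (D : rel V) (g : graph V) (h : graph W)
    (f : {ffun V -> W}) :
  reflect [/\ forall x y, adj g x y -> adj h (f x) (f y),
              forall x y, D x y -> f x = f y -> x = y
            & reg -> forall x y, D x y -> adj h (f x) (f y) -> adj g x y]
          (cmor reg D g h f).
Proof.
apply: (iffP andP) => [[/is_homP H1 /forallP H2]|[H1 H2 H3]].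
  have H x y : D x y -> ((f x == f y) ==> (x == y)) && (reg ==> adj h (f x) (f y) ==> adj g x y).
    by move=> xy; have /forallP/(_ y)/implyP/(_ xy) := H2 x.
  split=> // [x y /H/andP[/implyP I _] e|r x y /H/andP[_]].
    by apply/eqP; apply: I; apply/eqP.
  by rewrite r /= => /implyP.
split; first exact/is_homP.
apply/forallP=> x; apply/forallP=> y; apply/implyP=> xy; apply/andP; split.
  by apply/implyP=> /eqP /(H2 _ _ xy)->.
by apply/implyP=> r; apply/implyP; apply: H3.
Qed.

Lemma is_mono_cmor (V W : finType) (g : graph V) (h : graph W) f :
  is_mono g h f = cmor false (@full_rel V) g h f.
Proof.
apply/andP/cmorP => [[/is_homP H /injectiveP I]|[H I _]].
  by split=> // x y _; apply: I.
by split; [apply/is_homP | apply/injectiveP => x y; apply: I].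
Qed.

Lemma is_regmono_cmor (V W : finType) (g : graph V) (h : graph W) f :
  is_regmono g h f = cmor true (@full_rel V) g h f.
Proof.
rewrite is_regmonoE; apply/andP/cmorP => [[/injectiveP I /forallP H]|[H I R]].
  have H' x y : adj g x y = adj h (f x) (f y) by have /forallP/(_ y)/eqP := H x.
  by split=> [x y|x y _|_ x y _]; rewrite ?H' //; apply: I.
split; first by apply/injectiveP => x y; apply: I.
apply/forallP=> x; apply/forallP=> y; apply/eqP; apply/idP/idP; first exact: H.
exact: R.
Qed.

Lemma is_isoE (V W : finType) (g : graph V) (h : graph W) f :
  is_iso g h f = cmor true (@full_rel V) g h f && [forall y, exists x, f x == y].
Proof.
by rewrite -is_regmono_cmor is_regmonoE -andbA [X in _ && X]andbC.
Qed.

(** No edge of the target joins the two summands, so a homomorphism forces [S] to split the source.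
    Conversely, for a splitting, the conditions on a vertex of [S] and one outside hold
    automatically, since their images lie in different summands. *)
Lemma cmor_glue reg (V W1 W2 : finType) (g : graph V) (h1 : graph W1) (h2 : graph W2)
    (S : {set V}) p :
  cmor reg (@full_rel V) g (gunion h1 h2) (@glue V W1 W2 S p) =
  [&& splits g S, cmor reg (@full_rel _) (induced g S) h1 p.1
    & cmor reg (@full_rel _) (induced g (~: S)) h2 p.2].
Proof.
have gl u : glue p (val u) = inl (p.1 u) := glue_unpart p (inl u).
have gr u : glue p (val u) = inr (p.2 u) := glue_unpart p (inr u).
apply/cmorP/and3P => [[H I R]|[/splitsP gS /cmorP[H1 I1 R1] /cmorP[H2 I2 R2]]].
  split.
  - apply/splitsP=> x y /H; rewrite -(partK S x) -(partK S y) !glue_unpart.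
    case: (part S x) (part S y) => u [] v; rewrite adj_graph_of //= ?notin_setC //.
    by rewrite (valP u) (valP v).
  - apply/cmorP; split=> [x y|x y _ e|r x y _].
    + by rewrite adj_pull => /H; rewrite !gl adj_graph_of.
    + by apply/val_inj/I => //; rewrite !gl e.
    + by rewrite adj_pull => e; apply: R; rewrite // !gl adj_graph_of.
  - apply/cmorP; split=> [x y|x y _ e|r x y _].
    + by rewrite adj_pull => /H; rewrite !gr adj_graph_of.
    + by apply/val_inj/I => //; rewrite !gr e.
    + by rewrite adj_pull => e; apply: R; rewrite // !gr adj_graph_of.
have c x y : adj g x y -> (x \in S) = (y \in S) := gS x y.
split=> [x y|x y _|r x y _]; move: (c x y); rewrite -(partK S x) -(partK S y) !glue_unpart;
  case: (part S x) (part S y) => u [] v /=; rewrite ?notin_setC ?(valP u) ?(valP v).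
- by move=> _ uv; rewrite adj_graph_of; apply: H1; rewrite adj_pull.
- by move=> E /E.
- by move=> E /E.
- by move=> _ uv; rewrite adj_graph_of; apply: H2; rewrite adj_pull.
- by move=> _ [] /I1->.
- by [].
- by [].
- by move=> _ [] /I2->.
- by rewrite adj_graph_of => _ /(R1 r _ _ isT); rewrite adj_pull.
- by rewrite adj_graph_of.
- by rewrite adj_graph_of.
- by rewrite adj_graph_of => _ /(R2 r _ _ isT); rewrite adj_pull.
Qed.

Lemma surj_glue (V W1 W2 : finType) (S : {set V}) p :
  [forall y, exists x, @glue V W1 W2 S p x == y] =
  [forall y, exists x, p.1 x == y] && [forall y, exists x, p.2 x == y].
Proof.
apply/surjP/andP => [H|[/surjP H1 /surjP H2] [w|w]].
- split; apply/surjP=> w; [have [x] := H (inl w)|have [x] := H (inr w)];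
  rewrite -(partK S x) glue_unpart; case: (part S x) => // u [] <-; by exists u.
- by have [x <-] := H1 w; exists (val x); apply: glue_unpart p (inl x).
- by have [x <-] := H2 w; exists (val x); apply: glue_unpart p (inr x).
Qed.

Lemma is_iso_glue (V W1 W2 : finType) (g : graph V) (h1 : graph W1) (h2 : graph W2)
    (S : {set V}) p :
  is_iso g (gunion h1 h2) (@glue V W1 W2 S p) =
  [&& splits g S, is_iso (induced g S) h1 p.1 & is_iso (induced g (~: S)) h2 p.2].
Proof.
rewrite !is_isoE cmor_glue surj_glue.
by case: (splits g S) => //=; rewrite andbACA.
Qed.

(** A class of maps stable under isomorphisms of source and target has a cardinal depending only on
    the isomorphism classes; stability under the inverse isomorphisms gives surjectivity. This
    allows passing between a graph and the representative of its class. *)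
Lemma card_natural (Q : forall V W : finType, graph V -> graph W -> pred {ffun V -> W})
    (V V' W W' : finType) (g : graph V) (g' : graph V') (h : graph W) (h' : graph W') :
  (forall (V V' W W' : finType) (g : graph V) (g' : graph V') (h : graph W)
      (h' : graph W') (a : V' -> V) (b : W -> W') f,
    bijective a -> (forall x y, adj g' x y = adj g (a x) (a y)) ->
    bijective b -> (forall x y, adj h x y = adj h' (b x) (b y)) ->
    Q V W g h f -> Q V' W' g' h' [ffun x => b (f (a x))]) ->
  iso_exists g g' -> iso_exists h h' ->
  #|[set f | Q V W g h f]| = #|[set f | Q V' W' g' h' f]|.
Proof.
move=> QN; rewrite iso_sym => /iso_existsP[a [a' aK a'K] aA].
case/iso_existsP=> b [b' bK b'K] bA.
pose F (f : {ffun V -> W}) : {ffun V' -> W'} := [ffun x => b (f (a x))].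
apply: (card_bij (F := F)) => [f e _ _ /ffunP E|f|f].
- apply/ffunP=> x; have := E (a' x); rewrite !ffunE a'K.
  exact: (can_inj bK).
- by rewrite !inE; apply: QN => //; [exists a' | exists b'].
- rewrite inE => Qf; exists [ffun x => b' (f (a' x))].
    rewrite inE; apply: QN Qf => [|x y||x y]; [by exists a| |by exists b|].
    + by rewrite aA !a'K.
    + by rewrite bA !b'K.
  by apply/ffunP=> x; rewrite !ffunE aK b'K.
Qed.

Lemma cmor_natural reg (V V' W W' : finType) (D : rel V) (D' : rel V')
    (g : graph V) (g' : graph V') (h : graph W)
    (h' : graph W') (a : V' -> V) (b : W -> W') f :
  bijective a -> (forall x y, adj g' x y = adj g (a x) (a y)) ->
  bijective b -> (forall x y, adj h x y = adj h' (b x) (b y)) ->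
  (forall x y, D' x y -> D (a x) (a y)) ->
  cmor reg D g h f -> cmor reg D' g' h' [ffun x => b (f (a x))].
Proof.
move=> aB aA bB bA DD /cmorP[H I R]; apply/cmorP; split=> [x y|x y xy|r x y xy].
- by rewrite aA !ffunE -bA; apply: H.
- by rewrite !ffunE => /(bij_inj bB) /(I _ _ (DD _ _ xy)) /(bij_inj aB).
- by rewrite !ffunE aA -bA; apply: R r _ _ (DD _ _ xy).
Qed.

Lemma is_iso_natural (V V' W W' : finType) (g : graph V) (g' : graph V') (h : graph W)
    (h' : graph W') (a : V' -> V) (b : W -> W') f :
  bijective a -> (forall x y, adj g' x y = adj g (a x) (a y)) ->
  bijective b -> (forall x y, adj h x y = adj h' (b x) (b y)) ->
  is_iso g h f -> is_iso g' h' [ffun x => b (f (a x))].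
Proof.
move=> aB aA bB bA; rewrite !is_isoE => /andP[cf /surjP fS].
rewrite (cmor_natural aB aA bB bA _ cf) //; apply/surjP=> y.
have [b' bK b'K] := bB; have [a' aK a'K] := aB.
by have [x fx] := fS (b' y); exists (a' x); rewrite ffunE a'K fx b'K.
Qed.

Lemma card_iso_union (V W1 W2 : finType) (g : graph V) (h1 : graph W1) (h2 : graph W2) :
  #|[set f | is_iso g (gunion h1 h2) f]| =
  (\sum_(S | splits g S) #|[set f | is_iso (induced g S) h1 f]| *
                         #|[set f | is_iso (induced g (~: S)) h2 f]|)%N.
Proof.
apply: (card_glue (Q1 := fun S => is_iso (induced g S) h1)
                  (Q2 := fun S => is_iso (induced g (~: S)) h2)).
exact: is_iso_glue.
Qed.

Lemma card_cmor_union reg (V W1 W2 : finType) (g : graph V) (h1 : graph W1)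
    (h2 : graph W2) :
  #|[set f | cmor reg (@full_rel V) g (gunion h1 h2) f]| =
  (\sum_(S | splits g S) #|[set f | cmor reg (@full_rel _) (induced g S) h1 f]| *
     #|[set f | cmor reg (@full_rel _) (induced g (~: S)) h2 f]|)%N.
Proof.
apply: (card_glue (Q1 := fun S => cmor reg (@full_rel _) (induced g S) h1)
                  (Q2 := fun S => cmor reg (@full_rel _) (induced g (~: S)) h2)).
exact: cmor_glue.
Qed.

Lemma card_iso (V W : finType) (g : graph V) (h : graph W) :
  #|[set f | is_iso g h f]| = if class_of g == class_of h then Aut (class_of g) else 0%N.
Proof.
have iN := card_natural (Q := is_iso) is_iso_natural.
case: eqP => [/class_ofP gh|ngh]; last first.
  apply: eq_card0 => f; rewrite inE; apply/negP => fI; apply: ngh.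
  by apply/class_ofP/existsP; exists f.
have r := rep_class_of g; apply: iN; first by rewrite iso_sym.
by rewrite iso_sym; apply: iso_trans r gh.
Qed.

Lemma Aut_gt0 c : (0 < Aut c)%N.
Proof.
apply/card_gt0P; have /existsP[f fI] := iso_refl (rep c).
by exists f; rewrite inE.
Qed.

Lemma Aut_neq0 c : (Aut c)%:R != 0 :> rat.
Proof. by rewrite pnatr_eq0 -lt0n Aut_gt0. Qed.

End Cmor.

(** The isomorphisms from [rep c] to the union of [rep s] and [rep t] are counted twice: directly,
    they number [Aut c] if that union has class [c] and zero otherwise; sorted by splittings of
    [rep c], they number [Aut s] times [Aut t] times the coefficient. *)
Lemma cop_hom'_coeff c s t :
  (cop_hom' << c >>)@_(s, t) =
  (gadd s t == c)%:R * (Aut c)%:R / ((Aut s)%:R * (Aut t)%:R).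
Proof.
have nz2 : (Aut s)%:R * (Aut t)%:R != 0 :> rat by rewrite mulf_neq0 ?Aut_neq0.
apply: (canRL (mulfK nz2)).
have := card_iso_union (rep c) (rep s) (rep t).
rewrite card_iso class_of_rep -/(gadd s t) eq_sym.
move=> /(congr1 (fun n => n%:R : rat)) E.
have -> : (gadd s t == c)%:R * (Aut c)%:R = (if gadd s t == c then Aut c else 0%N)%:R :> rat.
  by case: eqP; rewrite ?mul1r ?mul0r.
rewrite E cop_hom'U /split_sum raddf_sum mulr_suml natr_sum.
apply: eq_bigr => S _; rewrite !card_iso !class_of_rep natrM /= mcoeffU xpair_eqE.
by do 2![case: eqP => [->|_] /=]; rewrite ?mul0r ?mulr0 ?mul1r.
Qed.

(** * The Hopf algebra of disjoint unions *)

Lemma tens_coeff (K L : choiceType) (x : freeQ K) (y : freeQ L) k l :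
  (tens x y)@_(k, l) = x@_k * y@_l.
Proof.
have mL := mcoeffs_linear (k, l).
move: x y; apply: (@lin_ext2 _ _ rat^o) => [y|x|y a u v|x a u v|k' l'].
- exact: (lin_comp mL (lin_tensl y (@lin_id _))).
- exact: (lin_comp mL (lin_tensr x (@lin_id _))).
- by rewrite mcoeffD mcoeffZ mulrDl scalerAl.
- by rewrite mcoeffD mcoeffZ mulrDr scalerAr.
- by rewrite tensU !mcoeffU xpair_eqE -natrM mulnb.
Qed.

Lemma lext_delta (K : choiceType) (F : K -> rat) q a (x : freeQ K) :
  (forall k, F k = (k == q)%:R * a) -> lext (F : K -> rat^o) x = a * x@_q.
Proof.
move=> FE; move: x; apply: (@lin_ext _ rat^o) => [||k].
- exact: lext_linear.
- by move=> b u v; rewrite mcoeffD mcoeffZ mulrDr scalerAr.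
- by rewrite lextU FE mcoeffU mulrC.
Qed.

Lemma tens_assoc_coeff (K : choiceType) (z : freeQ (K * K * K)%type) a b c :
  (tens_assoc z)@_(a, (b, c)) = z@_((a, b), c).
Proof.
move: z; apply: (@lin_ext _ rat^o) => [||[[a' b'] c']].
- exact: lin_comp (mcoeffs_linear _) (@tens_assoc_linear K).
- exact: mcoeffs_linear.
- by rewrite tens_assocU !mcoeffU !xpair_eqE andbA.
Qed.

Lemma Aut0 : Aut empty_class = 1%N.
Proof.
apply/eqP; rewrite eqn_leq Aut_gt0 andbT.
apply: leq_trans (max_card _) _; by rewrite card_ffun !card_ord gorder_empty.
Qed.

Lemma mul_hom_bilin :
  (forall y, linear (mul_hom ^~ y)) /\ (forall x, linear (mul_hom x)).
Proof. exact: lext2_bilin. Qed.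

Lemma mul_homE s t : mul_hom << s >> << t >> = << gadd s t >>.
Proof. exact: mul_homU. Qed.

Lemma bilin_assoc (K : choiceType) (m : freeQ K -> freeQ K -> freeQ K) (a : K -> K -> K) :
  (forall y, linear (m ^~ y)) -> (forall x, linear (m x)) ->
  (forall k l, m << k >> << l >> = << a k l >>) -> associative a -> associative m.
Proof.
move=> mL mR mE aA x y z; move: x y; apply: lin_ext2.
- by move=> y; apply: mL.
- by move=> x; apply: lin_comp (mR _) (mL _).
- by move=> y; apply: lin_comp (mL _) (mL _).
- by move=> x; apply: lin_comp (mL _) (mR _).
move=> k l; move: z; apply: lin_ext.
- exact: lin_comp (mR _) (mR _).
- exact: mR.
move=> t; apply: etrans (f_equal (m << k >>) (mE l t)) _.
apply: etrans (mE _ _) _; rewrite aA; apply/esym.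
by apply: etrans (f_equal (fun x => m x << t >>) (mE k l)) _; apply: mE.
Qed.

Lemma bilin_comm (K : choiceType) (m : freeQ K -> freeQ K -> freeQ K) (a : K -> K -> K) :
  (forall y, linear (m ^~ y)) -> (forall x, linear (m x)) ->
  (forall k l, m << k >> << l >> = << a k l >>) -> commutative a -> commutative m.
Proof.
move=> mL mR mE aC; apply: lin_ext2; [exact: mL|exact: mR|exact: mR|exact: mL|].
by move=> k l; apply: etrans (mE _ _) _; rewrite aC; apply/esym/mE.
Qed.

Lemma mul_homA : associative mul_hom.
Proof.
have [mL mR] := mul_hom_bilin; exact: bilin_assoc mL mR mul_homE gaddA.
Qed.

Lemma mul_homC : commutative mul_hom.
Proof.
have [mL mR] := mul_hom_bilin; exact: bilin_comm mL mR mul_homE gaddC.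
Qed.

Lemma mul_hom1x : left_id << empty_class >> mul_hom.
Proof.
have [mL mR] := mul_hom_bilin; apply: lin_ext; [exact: mR|exact: lin_id|].
by move=> k; rewrite mul_homE gadd0g.
Qed.

Lemma alg_hom_is_comm : is_comm_algebra alg_hom.
Proof.
have [mL mR] := mul_hom_bilin; split; last exact: mul_homC.
split; [exact: mL | exact: mR | exact: mul_homA | exact: mul_hom1x |].
by move=> x; apply: etrans (mul_homC _ _) (mul_hom1x _).
Qed.

Lemma cop_hom'_linear : linear cop_hom'.
Proof. by have [[]] := cop_hom'P. Qed.

Lemma eps_linear : linear (mcoeff empty_class : freeQ gclass -> rat^o).
Proof. exact: mcoeffs_linear. Qed.

(** On a class [t], both sides have at [a], [b], [c] the coefficient [Aut t] divided by the product
    of [Aut a], [Aut b] and [Aut c] if [t] is the union of the three, and zero otherwise. *)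
Lemma cop_hom'_assoc x :
  tens_assoc (tens_map cop_hom' id (cop_hom' x)) = tens_map id cop_hom' (cop_hom' x).
Proof.
move: x; apply: lin_ext => [||t].
- exact: lin_comp (@tens_assoc_linear _) (lin_comp (@tens_map_linear _ _ _ _ _ _) cop_hom'_linear).
- exact: lin_comp (@tens_map_linear _ _ _ _ _ _) cop_hom'_linear.
apply/malgP => -[a [b c]]; rewrite tens_assoc_coeff !lext_coeff.
rewrite (@lext_delta _ _ (gadd a b, c) ((Aut (gadd a b))%:R / ((Aut a)%:R * (Aut b)%:R))); last first.
  move=> [p q]; rewrite tens_coeff cop_hom'_coeff mcoeffU xpair_eqE /= [gadd a b == p]eq_sym.
  by case: eqP => [E|_]; rewrite ?E; case: eqP => [E'|_]; rewrite ?E' ?mul0r ?mulr0 ?mul1r ?mulr1.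
rewrite (@lext_delta _ _ (a, gadd b c) ((Aut (gadd b c))%:R / ((Aut b)%:R * (Aut c)%:R))); last first.
  move=> [p q]; rewrite tens_coeff cop_hom'_coeff mcoeffU xpair_eqE /= [gadd b c == q]eq_sym.
  by case: eqP => [E|_]; rewrite ?E; case: eqP => [E'|_]; rewrite ?E' ?mul0r ?mulr0 ?mul1r ?mulr1.
rewrite !cop_hom'_coeff gaddA.
by field; rewrite !Aut_neq0.
Qed.

Lemma cop_hom'_coalgebra : is_coalgebra (hopf_of hom_hom').
Proof.
have cL := cop_hom'_linear; split=> /=.
- exact: cL.
- exact: eps_linear.
- exact: cop_hom'_assoc.
- apply: lin_ext => [||t]; [exact: lin_comp (lext_linear _) cL | exact: lin_id |].
  apply/malgP => c; rewrite lext_coeff (@lext_delta _ _ (empty_class, c) 1) => [|[p q]].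
    rewrite cop_hom'_coeff gadd0g Aut0 mul1r mcoeffU eq_sym !mul1r.
    by case: eqP => [->|_]; rewrite ?mul0r // mul1r divff // Aut_neq0.
  by rewrite mcoeffZ !mcoeffU xpair_eqE mulr1 -natrM mulnb.
- apply: lin_ext => [||t]; [exact: lin_comp (lext_linear _) cL | exact: lin_id |].
  apply/malgP => c; rewrite lext_coeff (@lext_delta _ _ (c, empty_class) 1) => [|[p q]].
    rewrite cop_hom'_coeff gaddg0 Aut0 mulr1 mcoeffU eq_sym !mul1r.
    by case: eqP => [->|_]; rewrite ?mul0r // mul1r divff // Aut_neq0.
  by rewrite mcoeffZ !mcoeffU xpair_eqE mulr1 -natrM mulnb andbC.
Qed.

Lemma mulr_linl (B : comAlgType rat) (f : freeQ gclass -> B) y :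
  linear f -> linear (fun x => f x * y).
Proof. by move=> fL a u v; rewrite fL mulrDl scalerAl. Qed.

Lemma mulr_linr (B : comAlgType rat) (f : freeQ gclass -> B) y :
  linear f -> linear (fun x => y * f x).
Proof. by move=> fL a u v; rewrite fL mulrDr scalerAr. Qed.

Lemma hom_hom'_bialgebra : is_bialgebra (hopf_of hom_hom').
Proof.
have [[cL c1 cM] cg] := cop_hom'P; have [mL mR] := mul_hom_bilin.
split.
- by have [] := alg_hom_is_comm.
- exact: cop_hom'_coalgebra.
- by split; [exact: c1 | exact: cM].
- split; first exact: mcoeffUU.
  apply: (@lin_ext2 _ _ rat^o) => [y|x|y|x|k l].
  + exact: lin_comp eps_linear (mL _).
  + exact: lin_comp eps_linear (mR _).
  + exact: (@mulr_linl rat^o _ _ eps_linear).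
  + exact: (@mulr_linr rat^o _ _ eps_linear).
  apply: etrans (f_equal (mcoeff empty_class) (mul_homE k l)) _.
  apply: etrans (mcoeffU _ _ _) (esym (etrans (f_equal2 *%R (mcoeffU _ _ _) (mcoeffU _ _ _)) _)).
  by rewrite gadd_eq0 -natrM mulnb.
Qed.

(** * Characters of the tensor square composed with the coproduct *)

Section CharacterCop.
Variable w : gclass * gclass -> rat.
Hypothesis w1 : w (empty_class, empty_class) = 1.
Hypothesis wM : forall a b c d, w (gadd a c, gadd b d) = w (a, b) * w (c, d).

(** By [wM] the weight [w] is a character of the tensor square, so its composite with the algebra
    morphism [cop_hom'] is a character for disjoint union and is determined by its values on
    connected graphs. *)
Definition char_cop (t : gclass) : rat := lext (w : _ -> rat^o) (cop_hom' << t >>).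

Lemma char_copE t : char_cop t =
  \sum_(S | splits (rep t) S)
     w (class_of (induced (rep t) S), class_of (induced (rep t) (~: S))).
Proof.
rewrite /char_cop cop_hom'U /split_sum (lin_sum _ _ _ (@lext_linear _ _ _)).
by apply: eq_bigr => S _; apply: (lextU (w : _ -> rat^o)).
Qed.

Let F : _ -> rat^o := lext (w : _ -> rat^o).

Let FL : linear F.
Proof. exact: lext_linear. Qed.

Let F1 k : F << k >> = w k.
Proof. exact: lextU. Qed.

Lemma char_cop0 : char_cop empty_class = 1.
Proof.
have [[_ c1 _] _] := cop_hom'P.
by apply: etrans (f_equal F c1) _; rewrite /= tensU F1.
Qed.

Lemma char_cop_connected c : gconnected (rep c) ->
  char_cop c = w (c, empty_class) + w (empty_class, c).
Proof.
have [_ cg] := cop_hom'P => cc; have E := cg (exist _ c cc); rewrite /= in E.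
apply: etrans (f_equal F E) _; rewrite -[X in F (X + _)]scale1r FL scale1r.
apply: etrans (f_equal2 +%R (F1 _) (F1 _)) _; reflexivity.
Qed.

Lemma char_cop_gadd s t : char_cop (gadd s t) = char_cop s * char_cop t.
Proof.
have [[_ _ cM] _] := cop_hom'P; have [TL TR] := tens_mul_bilin alg_hom.
have FM z z' : F (amul (tens_algebra alg_hom) z z') = F z * F z'.
  move: z z'; apply: (@lin_ext2 _ _ rat^o) => [y|x|y|x|[a b] [c d]].
  - exact: lin_comp FL (TL _).
  - exact: lin_comp FL (TR _).
  - by move=> a u v; rewrite FL mulrDl -scalerAl.
  - by move=> a u v; rewrite FL mulrDr -scalerAr.
  apply: etrans (f_equal F (tens_mulU _ _)) (etrans (F1 _) _).
  by apply: etrans (wM _ _ _ _) (esym (f_equal2 *%R (F1 _) (F1 _))).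
rewrite /char_cop -mul_homE; apply: etrans (f_equal F (cM << s >> << t >>)) _.
exact: FM.
Qed.

Lemma char_cop_counit t :
  (forall c, gconnected (rep c) -> w (c, empty_class) + w (empty_class, c) = 0) ->
  char_cop t = (t == empty_class)%:R.
Proof.
move=> w0; elim/gclass_ind: t => [|c cc|s t IHs IHt].
- by rewrite char_cop0 eqxx.
- rewrite char_cop_connected // w0 //.
  case: eqP => // ce; move: cc; rewrite ce => /andP[].
  by rewrite card_ord lt0n gorder_eq0 eqxx.
- rewrite char_cop_gadd IHs IHt gadd_eq0.
  by case: (s == _); case: (t == _); rewrite ?mulr1 ?mulr0.
Qed.

End CharacterCop.

Lemma class_split (V : finType) (g : graph V) (S : {set V}) : splits g S ->
  gadd (class_of (induced g S)) (class_of (induced g (~: S))) = class_of g.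
Proof. by move=> gS; rewrite gadd_class -class_of_split. Qed.

Lemma hom_hom'_antipode :
  exists S, is_antipode (hopf_of hom_hom') S.
Proof.
(* sgn c = (-1) ^ (number of connected components of c) *)
pose sgn := chi (fun _ => -1 : rat).
have [mL mR] := mul_hom_bilin.
have s0 : sgn empty_class = 1 by apply: chi0.
have sM a b : sgn (gadd a b) = sgn a * sgn b by apply: chi_gadd.
have s1 c : gconnected (rep c) -> sgn c = -1 by move=> cc; rewrite /sgn chi_connected.
pose S : freeQ gclass -> freeQ gclass := lext (fun c => sgn c *: << c >>).
have SL : linear S by apply: lext_linear.
have SU c : S << c >> = sgn c *: << c >> by apply: lextU.
(* In each antipode identity, multiplying the two halves of a splitting gives back [t], so the left
   side is [char_cop w t] times [t]. On a connected graph the weights [1] and [-1] cancel, and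
   [char_cop w] is the counit. *)
have key (w : gclass * gclass -> rat) (F : gclass * gclass -> freeQ gclass) x :
    (forall p, F p = w p *: << gadd p.1 p.2 >>) ->
    w (empty_class, empty_class) = 1 ->
    (forall c, gconnected (rep c) -> w (c, empty_class) + w (empty_class, c) = 0) ->
    (forall a b c d, w (gadd a c, gadd b d) = w (a, b) * w (c, d)) ->
    lext F (cop_hom' x) = x@_empty_class *: << empty_class >>.
  move=> FE w1 w0 wM; move: x; apply: lin_ext => [||t].
  - exact: lin_comp (lext_linear _) cop_hom'_linear.
  - by move=> a u v; rewrite mcoeffD mcoeffZ scalerDl scalerA.
  transitivity (char_cop w t *: << t >> : freeQ gclass).
    rewrite char_copE cop_hom'U /split_sum (lin_sum _ _ _ (@lext_linear _ _ _)) scaler_suml.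
    apply: eq_bigr => A gA; apply: etrans (lextU _ _) _.
    by rewrite FE (class_split gA) class_of_rep.
  rewrite (char_cop_counit w1 wM t w0) mcoeffU.
  case: (t =P empty_class) => [te|_].
    rewrite te; reflexivity.
  exact: etrans (scale0r _) (esym (scale0r _)).
exists S; split=> //.
- move=> x; apply: (key (fun p => sgn p.1)) => //=.
  + by move=> p; rewrite SU (linZ _ _ (mL _)) mul_homE.
  + by move=> c /s1->; rewrite s0 addNr.
- move=> x; apply: (key (fun p => sgn p.2)) => //=.
  + by move=> p; rewrite SU (linZ _ _ (mR _)) mul_homE.
  + by move=> c /s1->; rewrite s0 subrr.
Qed.

Lemma hom_hom'_hopf : is_hopf (hopf_of hom_hom').
Proof. by split; [exact: hom_hom'_bialgebra | exact: hom_hom'_antipode]. Qed.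

Lemma hom_hom'_free : freely_generated (hopf_of hom_hom') cgen.
Proof.
split; first exact: alg_hom_is_comm.
move=> B b; have [mL mR] := mul_hom_bilin.
(* The value 1 is a default for the classes that are not connected. *)
pose b' c : B := if insub c : option {c | gconnected (rep c)} is Some t then b t else 1.
pose f : freeQ gclass -> B := lext (chi b').
have fL : linear f by apply: lext_linear.
have fU c : f << c >> = chi b' c by apply: lextU.
have fM u v : f (mul_hom u v) = f u * f v.
  move: u v; apply: lin_ext2 => [y|x|y|x|k l].
  + exact: lin_comp fL (mL _).
  + exact: lin_comp fL (mR _).
  + exact: mulr_linl.
  + exact: mulr_linr.
  apply: etrans (f_equal f (mul_homE k l)) (etrans (fU _) _).
  by apply: etrans (chi_gadd _ _ _) (esym (f_equal2 *%R (fU _) (fU _))).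
have f1 : f << empty_class >> = 1 by rewrite fU chi0.
have fg i : f (cgen i) = b i.
  by rewrite fU chi_connected ?(valP i) // /b' valK.
exists f; first by [].
move=> f' [f'L f'1 f'M f'g]; apply: lin_ext => // c.
elim/gclass_ind: c => [|c cc|s t IHs IHt].
- exact: etrans f'1 (esym f1).
- exact: etrans (f'g (exist _ c cc)) (esym (fg (exist _ c cc))).
- rewrite -mul_homE; apply: etrans (f'M << s >> << t >>) (etrans _ (esym (fM _ _))).
  congr (_ * _); [exact: IHs | exact: IHt].
Qed.

(** * Rescaling by automorphisms *)

Definition diag (w : gclass -> rat) : freeQ gclass -> freeQ gclass :=
  lext (fun c => w c *: << c >>).

Lemma diag_linear w : linear (diag w).
Proof. exact: lext_linear. Qed.

Lemma diagU w c : diag w << c >> = w c *: << c >>.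
Proof. exact: lextU. Qed.

Lemma diag_coeff w x c : (diag w x)@_c = w c * x@_c.
Proof. exact: lext_coeff_deltaE. Qed.

Lemma diag_bij w : (forall c, w c != 0) -> bijective (diag w).
Proof.
move=> w0; exists (diag (fun c => (w c)^-1)) => x; apply/malgP=> c.
  by rewrite !diag_coeff mulKf.
by rewrite !diag_coeff mulVKf.
Qed.

Lemma tens_diag_coeff w w' z k l :
  (tens_map (diag w) (diag w') z)@_(k, l) = w k * w' l * z@_(k, l).
Proof.
move: z; apply: (@lin_ext _ rat^o) => [||[k' l']].
- exact: lin_comp (mcoeffs_linear _) (@tens_map_linear _ _ _ _ _ _).
- by move=> a u v; rewrite mcoeffD mcoeffZ mulrDr scalerAr.
rewrite tens_mapU tens_coeff !diag_coeff !mcoeffU xpair_eqE -mulnb natrM.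
by ring.
Qed.

Lemma diag_unit w c : w c = 1 -> diag w << c >> = << c >>.
Proof. by move=> w1; rewrite diagU w1 scale1r. Qed.

(** The compatibility of a diagonal rescaling with product and coproduct, expressed on structure
    constants. *)
Lemma diag_hopf_equiv m m' D D' w :
  (forall y, linear (m ^~ y)) -> (forall x, linear (m x)) ->
  (forall y, linear (m' ^~ y)) -> (forall x, linear (m' x)) ->
  linear D -> linear D' ->
  (forall c, w c != 0) -> w empty_class = 1 ->
  (forall s t c, w c * (m << s >> << t >>)@_c = w s * w t * (m' << s >> << t >>)@_c) ->
  (forall c s t, w c * (D' << c >>)@_(s, t) = w s * w t * (D << c >>)@_(s, t)) ->
  hopf_equiv (hopf_with m D) (hopf_with m' D') (diag w).
Proof.
move=> mL mR m'L m'R DL D'L w0 w1 wm wD; have wL := diag_linear w; split.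
- split; [exact: wL | exact: diag_unit |].
  move=> x y; move: x y; apply: lin_ext2.
  + by move=> y; apply: lin_comp wL (mL _).
  + by move=> x; apply: lin_comp wL (mR _).
  + by move=> y; apply: lin_comp (m'L _) wL.
  + by move=> x; apply: lin_comp (m'R _) wL.
  move=> s t; apply/malgP=> c; rewrite diag_coeff.
  apply: etrans (wm _ _ _) _.
  have E : m' (diag w << s >>) (diag w << t >>) = w s *: (w t *: m' << s >> << t >>).
    apply: etrans (f_equal2 m' (diagU w s) (diagU w t)) _.
    by apply: etrans (linZ _ _ (m'L _)) (f_equal _ (linZ _ _ (m'R _))).
  by apply: esym (etrans (f_equal (mcoeff c) E) _); rewrite mcoeffZ mcoeffZ mulrA.
- exact: diag_bij.
- apply: lin_ext => [||c].
  + exact: lin_comp D'L wL.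
  + exact: lin_comp (@tens_map_linear _ _ _ _ _ _) DL.
  apply/malgP=> -[s t]; rewrite tens_diag_coeff -wD diagU.
  by apply: etrans (f_equal (mcoeff _) (linZ _ _ D'L)) _; rewrite mcoeffZ.
- by move=> x; rewrite /= diag_coeff w1 mul1r.
Qed.

Lemma cop_hom_linear : linear cop_hom.
Proof. exact: lext_linear. Qed.

(** The two coproducts match in general: at [(s, t)], the coefficient of [cop_hom'] is that of
    [cop_hom] times [Aut c] over [Aut s] times [Aut t]. Only the products remain to be compared. *)
Lemma hopf_equiv_Aut m m' :
  (forall y, linear (m ^~ y)) -> (forall x, linear (m x)) ->
  (forall y, linear (m' ^~ y)) -> (forall x, linear (m' x)) ->
  (forall s t c, (Aut c)%:R * (m << s >> << t >>)@_c =
                 (Aut s)%:R * (Aut t)%:R * (m' << s >> << t >>)@_c) ->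
  hopf_equiv (hopf_with m cop_hom') (hopf_with m' cop_hom)
             (diag (fun c => (Aut c)%:R)).
Proof.
move=> mL mR m'L m'R mm'; apply: diag_hopf_equiv => //.
- exact: cop_hom'_linear.
- exact: cop_hom_linear.
- exact: Aut_neq0.
- by rewrite Aut0.
move=> c s t; rewrite cop_hom_coeff cop_hom'_coeff -/(gadd s t).
by field; rewrite !Aut_neq0.
Qed.

Lemma hopf_equiv_hom'_hom :
  hopf_equiv (hopf_of hom_hom') (hopf_of hom'_hom) (diag (fun c => (Aut c)%:R)).
Proof.
have [mL mR] := mul_hom_bilin.
have [m'L m'R] : (forall y, linear (mul_hom' ^~ y)) /\ (forall x, linear (mul_hom' x)).
  exact: lext2_bilin.
apply: hopf_equiv_Aut mL mR m'L m'R _ => s t c.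
rewrite mul_hom'_coeff cop_hom'_coeff mul_homU mcoeffU -/(gadd s t).
by field; rewrite !Aut_neq0.
Qed.

Lemma hopf_equiv_mono'_hom :
  hopf_equiv (hopf_of mono_hom') (hopf_of mono'_hom) (diag (fun c => (Aut c)%:R)).
Proof.
have [mL mR] : (forall y, linear (mul_mono ^~ y)) /\ (forall x, linear (mul_mono x)).
  exact: lext2_bilin.
have [m'L m'R] : (forall y, linear (mul_mono' ^~ y)) /\ (forall x, linear (mul_mono' x)).
  exact: lext2_bilin.
apply: hopf_equiv_Aut mL mR m'L m'R _ => s t c.
apply: etrans (f_equal ( *%R _) (mul_mono_coeff s t c)) _.
apply: etrans _ (esym (f_equal ( *%R _) (mul_mono'_coeff s t c))).
by field; rewrite !Aut_neq0.
Qed.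

Lemma hopf_equiv_regmono'_hom :
  hopf_equiv (hopf_of regmono_hom') (hopf_of regmono'_hom) (diag (fun c => (Aut c)%:R)).
Proof.
have [mL mR] : (forall y, linear (mul_regmono ^~ y)) /\ (forall x, linear (mul_regmono x)).
  exact: lext2_bilin.
have [m'L m'R] : (forall y, linear (mul_regmono' ^~ y)) /\ (forall x, linear (mul_regmono' x)).
  exact: lext2_bilin.
apply: hopf_equiv_Aut mL mR m'L m'R _ => s t c.
apply: etrans (f_equal ( *%R _) (mul_regmono_coeff s t c)) _.
apply: etrans _ (esym (f_equal ( *%R _) (mul_regmono'_coeff s t c))).
by field; rewrite !Aut_neq0.
Qed.

(** It agrees with [Aut] on connected graphs and is multiplicative, whereas [Aut] is not when
    components repeat. *)
Definition aut_weight : gclass -> rat := chi (fun c => (Aut c)%:R).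

Lemma aut_weight_neq0 c : aut_weight c != 0.
Proof.
elim/gclass_ind: c => [|c cc|s t IHs IHt].
- by rewrite /aut_weight chi0 oner_eq0.
- by rewrite /aut_weight chi_connected ?Aut_neq0.
- by rewrite /aut_weight chi_gadd mulf_neq0.
Qed.

(** The structure constants vanish unless [c] is the union of [s] and [t], and there the weight of
    [c] is the product of the weights of [s] and [t]. *)
Lemma hopf_equiv_aut_weight :
  hopf_equiv (hopf_of hom_hom') (hopf_of hom_hom') (diag (fun c => (aut_weight c)^-1)).
Proof.
have [mL mR] := mul_hom_bilin.
apply: (diag_hopf_equiv mL mR mL mR cop_hom'_linear cop_hom'_linear).
- by move=> c; rewrite invr_eq0 aut_weight_neq0.
- by rewrite /aut_weight chi0 invr1.
- move=> s t c; rewrite mul_homU mcoeffU -/(gadd s t).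
  by case: eqP => [<-|_]; rewrite ?mulr0 // /aut_weight chi_gadd invfM.
- move=> c s t; rewrite cop_hom'_coeff.
  by case: eqP => [<-|_]; rewrite ?mul0r ?mulr0 // /aut_weight chi_gadd invfM.
Qed.

Lemma diag_weight_cgen (t : cgraph) :
  diag (fun c => (aut_weight c)^-1) (cgen t) = (Aut (val t))%:R^-1 *: cgen t.
Proof. by rewrite diagU /aut_weight chi_connected ?(valP t). Qed.

Lemma diag_Aut_cgen (t : cgraph) :
  diag (fun c => (Aut c)%:R) (cgen t) = (Aut (val t))%:R *: cgen t.
Proof. exact: diagU. Qed.

(** * Factorization through the image *)

Lemma is_epiP (V W : finType) (g : graph V) (h : graph W)
    (f : {ffun V -> W}) :
  reflect ((forall x y, adj g x y -> adj h (f x) (f y)) /\ forall y, exists x, f x = y)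
          (is_epi g h f).
Proof.
apply: (iffP andP) => [[/is_homP H /surjP S]|[H S]]; first by split.
by split; [apply/is_homP | apply/surjP].
Qed.

Lemma is_isoP (V W : finType) (g : graph V) (h : graph W) (f : {ffun V -> W}) :
  reflect [/\ injective f, forall y, exists x, f x = y
            & forall x y, adj g x y = adj h (f x) (f y)] (is_iso g h f).
Proof.
apply: (iffP and3P) => [[/injectiveP I /surjP S /forallP A]|[I S A]].
  by split=> // x y; have /forallP/(_ y)/eqP := A x.
split; [exact/injectiveP | exact/surjP |].
by apply/forallP=> x; apply/forallP=> y; rewrite A.
Qed.

(* The epimorphisms of the factorisation of a homomorphism through its image,
   which is a full subgraph if reg and carries only the image edges otherwise. *)
Definition epi (reg : bool) (V W : finType) (g : graph V) (h : graph W)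
    (f : {ffun V -> W}) :=
  if reg then is_epi g h f else is_regepi g h f.

Lemma epiP (reg : bool) (V W : finType) (g : graph V) (h : graph W)
    (f : {ffun V -> W}) :
  reflect [/\ forall x y, adj g x y -> adj h (f x) (f y),
              forall y, exists x, f x = y
            & ~~ reg -> forall y y', adj h y y' ->
                exists x x', [/\ adj g x x', f x = y & f x' = y']]
          (epi reg g h f).
Proof.
rewrite /epi; case: reg; first by apply: (iffP (is_epiP _ _ _)) => [[]|[]].
apply: (iffP andP) => [[/is_epiP[H S] /forallP E]|[H S E]].
  split=> // _ y y' yy'; have /forallP/(_ y')/implyP/(_ yy') := E y.
  by case/existsP=> x /existsP[x' /and3P[xx' /eqP ? /eqP ?]]; exists x, x'.
split; first exact/is_epiP.
apply/forallP=> y; apply/forallP=> y'; apply/implyP=> /(E isT)[x [x' [xx' ex ex']]].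
by apply/existsP; exists x; apply/existsP; exists x'; rewrite xx' ex ex' !eqxx.
Qed.

Section Image.
Variables (reg : bool) (V W : finType) (g : graph V) (h : graph W) (f : {ffun V -> W}).

Definition img_rel : rel W := fun y y' =>
  adj h y y' && (reg || [exists x, exists x', [&& adj g x x', f x == y & f x' == y']]).

Lemma img_relP y y' :
  reflect (adj h y y' /\
           (~~ reg -> exists x x', [/\ adj g x x', f x = y & f x' = y']))
          (img_rel y y').
Proof.
apply: (iffP andP) => [[-> E]|[-> E]]; split=> //.
  move=> /negbTE r; move: E; rewrite r /=.
  by case/existsP=> x /existsP[x' /and3P[xx' /eqP ? /eqP ?]]; exists x, x'.
case: reg E => //= /(_ isT)[x [x' [xx' ex ex']]].
by apply/existsP; exists x; apply/existsP; exists x'; rewrite xx' ex ex' !eqxx.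
Qed.

Lemma img_sym : symmetric img_rel.
Proof.
suff S y y' : img_rel y y' -> img_rel y' y by move=> y y'; apply/idP/idP; apply: S.
move=> /img_relP[a E]; apply/img_relP; rewrite adj_sym; split=> // /E[x [x' [xx' ex ex']]].
by exists x', x; rewrite adj_sym.
Qed.

Lemma img_irr : irreflexive img_rel.
Proof. by move=> y; rewrite /img_rel adj_irr. Qed.

Definition img : graph {y : W | y \in f @: [set: V]} :=
  induced (graph_of img_sym img_irr) (f @: [set: V]).

Lemma adj_img u v : adj img u v = img_rel (val u) (val v).
Proof. by rewrite adj_pull adj_graph_of. Qed.

Variables (U : finType) (k : graph U).

(** The isomorphisms from [k] to [img], followed by the inclusion into [W], so that they can be
    compared with maps from [k] to [h]. *)
Definition img_iso : {set {ffun U -> W}} :=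
  [set m : {ffun U -> W} | [&& injectiveb m, m @: [set: U] == f @: [set: V]
             & [forall u, forall v, adj k u v == img_rel (m u) (m v)]]].

Lemma img_isoP (m : {ffun U -> W}) :
  reflect [/\ injective m, m @: [set: U] = f @: [set: V]
            & forall u v, adj k u v = img_rel (m u) (m v)] (m \in img_iso).
Proof.
rewrite inE; apply: (iffP and3P) => [[/injectiveP I /eqP E /forallP A]|[I E A]].
  by split=> // u v; have /forallP/(_ v)/eqP := A u.
split; [exact/injectiveP | exact/eqP |].
by apply/forallP=> u; apply/forallP=> v; rewrite A.
Qed.

Lemma card_img_iso :
  #|img_iso| = if class_of k == class_of img then Aut (class_of k) else 0%N.
Proof.
rewrite -card_iso; apply/esym.
pose F (p : {ffun U -> {y : W | y \in f @: [set: V]}}) : {ffun U -> W} := [ffun u => val (p u)].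
apply: (card_bij (F := F)) => [p q _ _ /ffunP E|p|m].
- by apply/ffunP=> u; apply: val_inj; have := E u; rewrite !ffunE.
- rewrite inE => /is_isoP[I S A]; apply/img_isoP; split.
  + by move=> u v; rewrite !ffunE => /val_inj/I.
  + apply/setP=> y; apply/imsetP/idP => [[u _ ->]|yf]; first by rewrite ffunE (valP (p u)).
    by have [u pu] := S (exist _ y yf); exists u; rewrite // ffunE pu.
  + by move=> u v; rewrite A adj_img !ffunE.
- case/img_isoP => I E A.
  have mf u : m u \in f @: [set: V] by rewrite -E imset_f ?inE.
  exists [ffun u => exist (fun y => y \in f @: [set: V]) (m u) (mf u)].
    rewrite inE; apply/is_isoP; split.
    * by move=> u v; rewrite !ffunE => -[] /I.
    * move=> [y yf]; have /imsetP[u _ yu] : y \in m @: [set: U] by rewrite E.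
      by exists u; rewrite ffunE; apply: val_inj; rewrite /= yu.
    * by move=> u v; rewrite adj_img !ffunE A.
  by apply/ffunP=> u; rewrite !ffunE.
Qed.

End Image.

(* A pair (e, m) is recovered from (m o e, m), and the m that occur with a given
   composite are the isomorphisms onto its image. *)
Lemma card_epi_mono (reg : bool) (V W U : finType) (D : rel V) (g : graph V)
    (h : graph W) (k : graph U) :
  (#|[set e | epi reg g k e && cmor reg D g k e]| *
   #|[set m | cmor reg (@full_rel U) k h m]| =
   \sum_(f : {ffun V -> W} | cmor reg D g h f) #|img_iso reg g h f k|)%N.
Proof.
rewrite -cardsX.
pose X : {set {ffun V -> W} * {ffun U -> W}} :=
  [set p | cmor reg D g h p.1 && (p.2 \in img_iso reg g h p.1 k)].
have -> : (\sum_(f : {ffun V -> W} | cmor reg D g h f) #|img_iso reg g h f k|)%N = #|X|.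
  rewrite -sum1_card; under [LHS]eq_bigr => f _ do rewrite -sum1_card.
  by rewrite pair_big_dep; apply: eq_bigl => p; rewrite [in RHS]inE.
pose F (p : {ffun V -> U} * {ffun U -> W}) : {ffun V -> W} * {ffun U -> W} :=
  ([ffun x => p.2 (p.1 x)], p.2).
apply: (card_bij (F := F)) => [[e m] [e' m']|[e m]|[f m]].
- rewrite !inE /= => /andP[_ /cmorP[_ I _]] _ [/ffunP E mm]; subst m'.
  by congr (_, _); apply/ffunP=> x; apply: I => //; have := E x; rewrite !ffunE.
- case/setXP=> + mP; rewrite inE in mP; rewrite inE => /andP[/epiP[eH eS eE] /cmorP[_ eI eR]].
  have /cmorP[mH mI mR] := mP; rewrite [F _ \in X]inE /=; apply/andP; split.
    apply/cmorP; split=> [x y /eH/mH|x y xy|r x y xy].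
    + by rewrite !ffunE.
    + by rewrite !ffunE => /(mI _ _ isT)/(eI _ _ xy).
    + by rewrite !ffunE => /(mR r _ _ isT)/(eR r _ _ xy).
  apply/img_isoP; split=> [u v|| u v].
  + exact: mI.
  + apply/setP=> y; apply/imsetP/imsetP => [[u _ ->]|[x _ ->]].
      by have [x <-] := eS u; exists x; rewrite // ffunE.
    by exists (e x); rewrite // ffunE.
  + apply/idP/img_relP => [uv|[muv E]].
      split; first exact: mH.
      by move=> /eE/(_ _ _ uv)[x [x' [xx' <- <-]]]; exists x, x'; rewrite !ffunE.
    have [r|r] := boolP reg; first exact: mR.
    have [x [x' [xx']]] := E r; rewrite !ffunE => /(mI _ _ isT)<- /(mI _ _ isT)<-.
    exact: eH.
- rewrite inE /= => /andP[/cmorP[fH fI fR] /img_isoP[mI mS mA]].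
  have ex x : exists u, m u == f x.
    have : f x \in m @: [set: U] by rewrite mS imset_f ?inE.
    by case/imsetP=> u _ ->; exists u.
  pose e : {ffun V -> U} := [ffun x => xchoose (ex x)].
  have eK x : m (e x) = f x by rewrite ffunE; apply/eqP/(xchooseP (ex x)).
  exists (e, m); last by congr (_, _); apply/ffunP=> x; rewrite ffunE eK.
  have eH x y : adj g x y -> adj k (e x) (e y).
    move=> xy; rewrite mA !eK; apply/img_relP; split; first exact: fH.
    by move=> _; exists x, y.
  rewrite !inE /=; apply/andP; split; first (apply/andP; split).
  + apply/epiP; split=> // [u|r u v].
      have : m u \in f @: [set: V] by rewrite -mS imset_f ?inE.
      by case/imsetP=> x _ mu; exists x; apply: mI; rewrite eK.
    rewrite mA => /img_relP[_ /(_ r)[x [x' [xx' ux vx']]]].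
    by exists x, x'; split=> //; apply: mI; rewrite eK.
  + apply/cmorP; split=> // [x y xy exy|r x y xy].
      by apply: fI => //; rewrite -!eK exy.
    by rewrite mA !eK => /img_relP[fxy _]; apply: fR fxy.
  + apply/cmorP; split=> [u v|u v _|r u v _].
    * by rewrite mA => /img_relP[].
    * exact: mI.
    * by move=> muv; rewrite mA; apply/img_relP; split; rewrite ?r.
Qed.

(** * Counting functions and the sum over images *)

Lemma msupp_formal_sum (K : choiceType) (c : K -> rat) (d : {fset K}) :
  (forall i, i \notin d -> c i = 0) -> (msupp (formal_sum c) `<=` d)%fset.
Proof.
move=> c0; apply/fsubsetP => k; apply: contraLR => kd.
by rewrite -mcoeff_eq0 (formal_sumE _ c0) c0.
Qed.

Lemma sum_fset_delta (K : choiceType) (d : {fset K}) (k : K) :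
  k \in d -> \sum_(c <- d) (c == k)%:R = 1 :> rat.
Proof.
move=> kd; rewrite (big_fsetD1 k) //= eqxx big1_seq ?addr0 // => c /andP[_].
by rewrite !inE => /andP[/negbTE->].
Qed.

Definition ncount (reg : bool) (s t : gclass) : rat :=
  #|[set f | cmor reg (@full_rel _) (rep s) (rep t) f]|%:R.

(** Epimorphisms onto [c] up to automorphisms of [c]. With [same_side] for [D] these are the
    structure constants of the mono and regmono products; with connectivity they are the
    coefficients of [psihat]. *)
Definition epi_coef (reg : bool) (V : finType) (D : rel V) (g : graph V) (c : gclass) : rat :=
  #|[set e | epi reg g (rep c) e && cmor reg D g (rep c) e]|%:R / (Aut c)%:R.

Lemma epi_coef_support (reg : bool) (V : finType) (D : rel V) (g : graph V) c :
  c \notin classes_le #|V| -> epi_coef reg D g c = 0.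
Proof.
rewrite mem_classes_le => cV; rewrite /epi_coef eq_card0 ?mul0r // => e.
rewrite inE; apply/negP=> /andP[eE _]; case/negP: cV.
rewrite -[X in (X <= _)%N]card_ord; apply: (@epi_card _ _ g (rep c) e).
by move: eE; rewrite /epi; case: reg => // /andP[].
Qed.

Lemma epi_coefE (reg : bool) (V : finType) (D : rel V) (g : graph V) c :
  (formal_sum (epi_coef reg D g))@_c = epi_coef reg D g c.
Proof. exact/formal_sumE/epi_coef_support. Qed.

(** Summing [card_epi_mono] over the classes [c], each map [f] on the right is counted for the class
    of its image only, with multiplicity [Aut c], which the denominator of [epi_coef] cancels. The
    image has at most [#|V|] vertices, so its class does occur in the sum. *)
Lemma factorization (reg : bool) (V : finType) (D : rel V) (g : graph V) (t : gclass) :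
  lext (fun c => ncount reg c t : rat^o) (formal_sum (epi_coef reg D g)) =
  #|[set f | cmor reg D g (rep t) f]|%:R.
Proof.
rewrite (lextEw _ (msupp_formal_sum (epi_coef_support reg D g))).
transitivity (\sum_(c <- classes_le #|V|)
    \sum_(f | cmor reg D g (rep t) f) (c == class_of (img reg g (rep t) f))%:R : rat).
  apply: eq_bigr => c _; rewrite epi_coefE; apply: (mulIf (Aut_neq0 c)).
  rewrite /GRing.scale /= mulrAC /epi_coef mulfVK ?Aut_neq0 // /ncount -natrM card_epi_mono.
  rewrite natr_sum mulr_suml; apply: eq_bigr => f _; rewrite card_img_iso class_of_rep.
  by case: eqP; rewrite ?mul1r ?mul0r.
rewrite exchange_big -[in RHS]sum1_card natr_sum [RHS](eq_bigl (cmor reg D g (rep t))).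
  apply: eq_bigr => f _; apply: sum_fset_delta.
  rewrite mem_classes_le gorder_class_of card_sig.
  have -> : #|[pred x | x \in f @: [set: V]]| = #|f @: [set: V]| by apply: eq_card.
  by apply: leq_trans (leq_imset_card _ _) _; rewrite cardsT.
by move=> f; rewrite inE.
Qed.

(** * Multiplicativity and triangularity of the counts *)

Section UnionMaps.
Variables (V1 V2 W : finType) (g1 : graph V1) (g2 : graph V2) (h : graph W).
Variables (D : rel (V1 + V2)) (D1 : rel V1) (D2 : rel V2).
Hypothesis Dll : forall x y, D (inl x) (inl y) = D1 x y.
Hypothesis Drr : forall x y, D (inr x) (inr y) = D2 x y.
Hypothesis Dlr : forall x y, D (inl x) (inr y) = false.
Hypothesis Drl : forall x y, D (inr x) (inl y) = false.

(** As [D] relates no vertices of different summands, every condition concerns one restriction only.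
    This is applied to [same_side] and to connectivity in the union. *)
Lemma cmor_gunion (reg : bool) (f : {ffun V1 + V2 -> W}) :
  cmor reg D (gunion g1 g2) h f =
  cmor reg D1 g1 h (restrl f) && cmor reg D2 g2 h (restrr f).
Proof.
apply/cmorP/andP => [[H I R]|[/cmorP[H1 I1 R1] /cmorP[H2 I2 R2]]].
  split; apply/cmorP; split=> [x y xy|x y xy|r x y xy]; rewrite !ffunE.
  - by apply: H; rewrite adj_graph_of.
  - by rewrite -Dll in xy; case/(I _ _ xy).
  - by rewrite -Dll in xy; move/(R r _ _ xy); rewrite adj_graph_of.
  - by apply: H; rewrite adj_graph_of.
  - by rewrite -Drr in xy; case/(I _ _ xy).
  - by rewrite -Drr in xy; move/(R r _ _ xy); rewrite adj_graph_of.
split=> [[x|x] [y|y]|[x|x] [y|y]|r [x|x] [y|y]];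
  rewrite ?adj_graph_of ?Dlr ?Drl ?Dll ?Drr //= => xy.
- by have := H1 x y xy; rewrite !ffunE.
- by have := H2 x y xy; rewrite !ffunE.
- by have := I1 x y xy; rewrite !ffunE => E /E->.
- by have := I2 x y xy; rewrite !ffunE => E /E->.
- by have := R1 r x y xy; rewrite !ffunE.
- by have := R2 r x y xy; rewrite !ffunE.
Qed.

Lemma card_cmor_gunion (reg : bool) :
  #|[set f | cmor reg D (gunion g1 g2) h f]| =
  (#|[set f | cmor reg D1 g1 h f]| * #|[set f | cmor reg D2 g2 h f]|)%N.
Proof.
rewrite -cardsX; pose F (f : {ffun V1 + V2 -> W}) := (restrl f, restrr f).
apply: (card_bij (F := F)) => [f e _ _ [/ffunP El /ffunP Er]|f|[f1 f2]].
- apply/ffunP=> -[x|x]; first by have := El x; rewrite !ffunE.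
  by have := Er x; rewrite !ffunE.
- by rewrite inE cmor_gunion in_setX !inE.
- rewrite in_setX !inE => /= fE.
  pose f : {ffun V1 + V2 -> W} := [ffun z => match z with inl x => f1 x | inr y => f2 y end].
  have fK : F f = (f1, f2) by congr (_, _); apply/ffunP=> x; rewrite !ffunE.
  by exists f => //; rewrite inE cmor_gunion; case: fK => -> ->.
Qed.

End UnionMaps.

Definition same_side (A B : Type) (x y : A + B) : bool :=
  match x, y with inl _, inl _ | inr _, inr _ => true | _, _ => false end.

Lemma connect_hom (V W : finType) (g : graph V) (h : graph W) (f : V -> W) x y :
  (forall x y, adj g x y -> adj h (f x) (f y)) ->
  connect (adj g) x y -> connect (adj h) (f x) (f y).
Proof.
move=> fH /connectP[p pg ->]; apply/connectP; exists (map f p); last by rewrite last_map.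
elim: p x pg => //= z p IHp x /andP[xz pg].
by rewrite fH //; apply: IHp.
Qed.

Section ConnectUnion.
Variables (V W : finType) (g : graph V) (h : graph W).

Lemma connect_inl x y :
  connect (adj (gunion g h)) (inl x) (inl y) = connect (adj g) x y.
Proof.
apply/idP/idP => [/connectP[p]|]; last first.
  by apply: connect_hom => a b; rewrite adj_graph_of.
elim: p x => [|[z|z] p IHp] x /=; first by move=> _ [->]; apply: connect0.
  rewrite adj_graph_of /= => /andP[xz pp] e.
  exact: connect_trans (connect1 xz) (IHp z pp e).
by rewrite adj_graph_of.
Qed.

Lemma connect_inr x y :
  connect (adj (gunion g h)) (inr x) (inr y) = connect (adj h) x y.
Proof.
apply/idP/idP => [/connectP[p]|]; last first.
  by apply: connect_hom => a b; rewrite adj_graph_of.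
elim: p x => [|[z|z] p IHp] x /=; first by move=> _ [->]; apply: connect0.
  by rewrite adj_graph_of.
rewrite adj_graph_of /= => /andP[xz pp] e.
exact: connect_trans (connect1 xz) (IHp z pp e).
Qed.

Let lset : {set V + W} := [set z | if z is inl _ then true else false].

Let lsplits : splits (gunion g h) lset.
Proof. by apply/splitsP=> -[x|x] [y|y]; rewrite adj_graph_of // !inE. Qed.

Lemma connect_inlr x y : connect (adj (gunion g h)) (inl x) (inr y) = false.
Proof. by apply/negP=> /(split_connect lsplits); rewrite !inE. Qed.

Lemma connect_inrl x y : connect (adj (gunion g h)) (inr x) (inl y) = false.
Proof. by apply/negP=> /(split_connect lsplits); rewrite !inE. Qed.

End ConnectUnion.

Definition Ncount (reg : bool) (c t : gclass) : rat :=
  #|[set f | cmor reg (connect (adj (rep c))) (rep c) (rep t) f]|%:R.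

Lemma ncountE (reg : bool) (V W : finType) (g : graph V) (h : graph W) :
  ncount reg (class_of g) (class_of h) = #|[set f | cmor reg (@full_rel V) g h f]|%:R.
Proof.
congr (_%:R).
apply: (card_natural (Q := fun V W g h => cmor reg (@full_rel V) g h)); try exact: rep_class_of.
by move=> *; apply: cmor_natural; eauto.
Qed.

Lemma NcountE (reg : bool) (V W : finType) (g : graph V) (h : graph W) :
  Ncount reg (class_of g) (class_of h) =
  #|[set f | cmor reg (connect (adj g)) g h f]|%:R.
Proof.
congr (_%:R).
apply: (card_natural (Q := fun V W g h => cmor reg (connect (adj g)) g h)); try exact: rep_class_of.
move=> V' V'' W' W'' g' g'' h' h'' a b f aB aA bB bA.
apply: cmor_natural => // x y; apply: connect_hom => u v; by rewrite aA.
Qed.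

Lemma Ncount_gadd reg s t c : Ncount reg (gadd s t) c = Ncount reg s c * Ncount reg t c.
Proof.
rewrite -{1}(class_of_rep c) NcountE -natrM; congr (_%:R).
apply: card_cmor_gunion => x y.
- exact: connect_inl.
- exact: connect_inr.
- exact: connect_inlr.
- exact: connect_inrl.
Qed.

Lemma Ncount_connected reg c t : (forall x y, connect (adj (rep c)) x y) ->
  Ncount reg c t = ncount reg c t.
Proof.
move=> cc; congr (_%:R); apply: eq_card => f; rewrite !inE.
by apply/cmorP/cmorP => -[H I R]; split=> // [x y _|r x y _]; [apply: I|apply: R|apply: I|apply: R].
Qed.

Lemma ncount_split reg c s t :
  ncount reg c (gadd s t) = \sum_(S | splits (rep c) S)
    ncount reg (class_of (induced (rep c) S)) s *
    ncount reg (class_of (induced (rep c) (~: S))) t.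
Proof.
rewrite -{1}(class_of_rep c) ncountE card_cmor_union natr_sum.
apply: eq_bigr => S _; rewrite natrM -[in RHS](class_of_rep s) -[in RHS](class_of_rep t).
by rewrite !ncountE.
Qed.

Lemma rep_empty (x : 'I_(gorder empty_class)) : False.
Proof. by have := ltn_ord x; rewrite [X in (_ < X)%N]gorder_empty. Qed.

Lemma ncount_empty reg t : ncount reg empty_class t = 1.
Proof.
rewrite /ncount -[RHS]/(1%:R); congr (_%:R).
rewrite (_ : [set f | _] = [set: {ffun 'I_(gorder empty_class) -> 'I_(gorder t)}]).
  by rewrite cardsT card_ffun !card_ord gorder_empty.
apply/setP=> f; rewrite !inE; apply/cmorP.
by split=> [x|x|_ x]; case: (rep_empty x).
Qed.

(* ncount is triangular for inc_size, and psihat for the size of coadj_set. *)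
Definition inc_size (V : finType) (g : graph V) : nat :=
  #|V| + #|[set p : V * V | adj g p.1 p.2]|.

Definition coadj_set (V : finType) (g : graph V) : {set V * V} :=
  [set p | ~~ adj g p.1 p.2].

(** An embedding is injective on vertices and on edges; if the total size does not grow, it is onto
    for both, hence an isomorphism. *)
Lemma cmor_inc_size reg (V W : finType) (g : graph V) (h : graph W) f :
  cmor reg (@full_rel V) g h f -> (inc_size g < inc_size h)%N \/ iso_exists g h.
Proof.
move=> /cmorP[H I _]; have fI : injective f by move=> x y; apply: I.
pose F (p : V * V) := (f p.1, f p.2).
have FI : injective F by move=> [x y] [x' y'] [/fI-> /fI->].
set E := [set p : V * V | adj g p.1 p.2]; set E' := [set p : W * W | adj h p.1 p.2].
have FE : F @: E \subset E'.
  by apply/fintype.subsetP=> _ /imsetP[[x y] + ->]; rewrite !inE; apply: H.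
have cV : (#|V| <= #|W|)%N by apply: leq_card fI.
have cE : (#|E| <= #|E'|)%N by rewrite -(card_imset _ FI); apply: subset_leq_card.
have [lt|] := ltnP (inc_size g) (inc_size h); [by left | move=> le; right].
have {}le : (#|W| + #|E'| <= #|V| + #|E|)%N := le.
have WV : (#|W| <= #|V|)%N.
  by rewrite -(leq_add2r #|E'|); apply: leq_trans le _; rewrite leq_add2l.
have EE : (#|E'| <= #|E|)%N.
  by rewrite -(leq_add2l #|W|); apply: leq_trans le _; rewrite leq_add2r.
have FE' : F @: E = E' by apply/eqP; rewrite eqEcard FE card_imset.
have fS y : exists x, f x = y.
  have : y \in codom f by apply: inj_card_onto.
  by case/codomP=> x ->; exists x.
apply: (@is_isoI _ _ _ _ f) => // x y; apply/idP/idP; first exact: H.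
move=> xy; have : F (x, y) \in E' by rewrite inE.
by rewrite -FE' mem_imset // inE.
Qed.

(** Along a surjective homomorphism, each non-adjacent pair of [h] lifts to a non-adjacent pair of
    [g]. If their number does not drop, non-adjacent pairs correspond bijectively and [f] is an
    isomorphism. *)
Lemma epi_coadj (V W : finType) (g : graph V) (h : graph W) f :
  is_epi g h f -> (#|coadj_set h| < #|coadj_set g|)%N \/ iso_exists g h.
Proof.
case/is_epiP=> H S; pose F (p : V * V) := (f p.1, f p.2).
have hF : coadj_set h \subset F @: coadj_set g.
  apply/fintype.subsetP=> -[y y']; rewrite inE /=.
  have [x <-] := S y; have [x' <-] := S y' => xx'.
  apply/imsetP; exists (x, x') => //; rewrite inE /=.
  by apply: contraNN xx'; apply: H.
have le := subset_leq_card hF; have le' := leq_imset_card F (coadj_set g).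
have [lt|ge] := ltnP #|coadj_set h| #|coadj_set g|; [by left | right].
have FI : {in coadj_set g &, injective F}.
  by apply/imset_injP; rewrite eqn_leq le' (leq_trans ge le).
have hFE : F @: coadj_set g = coadj_set h.
  by apply/esym/eqP; rewrite eqEcard hF (leq_trans le' ge).
(* Diagonal pairs are never adjacent, so injectivity on non-adjacent pairs applies to [(x, x)] and
   [(y, y)]. *)
have fI : injective f.
  move=> x y xy; have /FI : (x, x) \in coadj_set g by rewrite inE adj_irr.
  by move=> /(_ (y, y)); rewrite inE adj_irr /F /= xy => /(_ isT erefl)[].
apply: (@is_isoI _ _ _ _ f) => // x y; apply/idP/idP; first exact: H.
apply: contraLR => xy; have : F (x, y) \in coadj_set h.
  by rewrite -hFE imset_f // inE.
by rewrite inE.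
Qed.

Lemma ncount_self reg c : ncount reg c c != 0.
Proof.
rewrite pnatr_eq0 -lt0n; apply/card_gt0P; exists [ffun x => x]; rewrite inE.
by apply/cmorP; split=> [x y|x y _|r x y _]; rewrite !ffunE.
Qed.

Lemma ncount_neq0 reg s t : ncount reg s t != 0 ->
  (inc_size (rep s) < inc_size (rep t))%N \/ s = t.
Proof.
rewrite pnatr_eq0 -lt0n => /card_gt0P[f]; rewrite inE => /cmor_inc_size[]; first by left.
by move/class_ofP; rewrite !class_of_rep; right.
Qed.

(** * Triangular linear maps *)

Lemma seq_extremum (T : eqType) (e : rel nat) (nu : T -> nat) (s : seq T) :
  total e -> transitive e -> s != [::] ->
  exists2 k, k \in s & forall l, l \in s -> e (nu k) (nu l).
Proof.
move=> eT eTr; have er n : e n n by have := eT n n; rewrite orbb.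
elim: s => // k s IHs _; have [->|/IHs[m ms Hm]] := eqVneq s [::].
  by exists k; rewrite ?inE // => l; rewrite inE => /eqP->.
have [km|mk] := orP (eT (nu k) (nu m)); [exists k | exists m]; rewrite ?inE ?eqxx ?ms ?orbT //.
  by move=> l; rewrite inE => /orP[/eqP->//|/Hm]; apply: eTr.
by move=> l; rewrite inE => /orP[/eqP->//|/Hm].
Qed.

Lemma lext_isolated (K : choiceType) (n : K -> rat) (u : freeQ K) k :
  k \in msupp u -> (forall l, l \in msupp u -> n l != 0 -> l = k) ->
  lext (n : K -> rat^o) u = u@_k * n k.
Proof.
move=> ku iso; rewrite /lext (big_fsetD1 k ku) /= big1_seq ?addr0 // => l /andP[_].
rewrite !inE => /andP[lk lu]; have [->|/(iso l lu) e] := eqVneq (n l) 0.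
  by rewrite scaler0.
by rewrite e eqxx in lk.
Qed.

(** The order [e] is left arbitrary so that both a minimum and a maximum of [nu] on the support are
    available. *)
Lemma msupp_neq0P (K : choiceType) (u : freeQ K) :
  (forall e : rel nat, total e -> transitive e -> forall nu : K -> nat, exists2 k,
     k \in msupp u & forall l, l \in msupp u -> e (nu k) (nu l)) \/ u = 0.
Proof.
have [->|u0] := eqVneq u 0; [by right | left=> e eT eTr nu].
apply: seq_extremum => //; apply: contraNneq u0 => E; apply/eqP/malgP => k.
rewrite mcoeff0 mcoeff_outdom //; apply/negP => ku.
by have : k \in enum_fset (msupp u) := ku; rewrite E.
Qed.

(** If [k] minimizes [nu] on the support of [u], the functional of [k] sees no other term of [u], so
    it cannot vanish. *)
Lemma triangular_lower_inj (K : choiceType) (nu : K -> nat) (n : K -> K -> rat) (u : freeQ K) :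
  (forall k, n k k != 0) -> (forall k l, n k l != 0 -> (nu k < nu l)%N \/ k = l) ->
  (forall l, lext (n^~ l : K -> rat^o) u = 0) -> u = 0.
Proof.
move=> nd nt u0; have [U|//] := msupp_neq0P u.
have [k ku kmin] := U _ leq_total leq_trans nu.
have /eqP := u0 k; rewrite (@lext_isolated _ _ _ k) //.
  by rewrite mulf_eq0 (negbTE (nd k)) orbF mcoeff_eq0 ku.
move=> l lu /nt[] // lk; have := kmin l lu; by rewrite leqNgt lk.
Qed.

Lemma triangular_upper_inj (K : choiceType) (nu : K -> nat) (n : K -> K -> rat) (u : freeQ K) :
  (forall k, n k k != 0) -> (forall k l, n k l != 0 -> (nu l < nu k)%N \/ k = l) ->
  (forall l, lext (n^~ l : K -> rat^o) u = 0) -> u = 0.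
Proof.
move=> nd nt u0; have [U|//] := msupp_neq0P u.
have gT : total geq by move=> a b; apply: leq_total.
have gTr : transitive geq by move=> a b c ba ac; apply: leq_trans ac ba.
have [k ku kmax] := U _ gT gTr nu.
have /eqP := u0 k; rewrite (@lext_isolated _ _ _ k) //.
  by rewrite mulf_eq0 (negbTE (nd k)) orbF mcoeff_eq0 ku.
move=> l lu /nt[] // kl; have := kmax l lu; by rewrite /= leqNgt kl.
Qed.

Lemma lin_inj (U V : lmodType rat) (f : U -> V) :
  linear f -> (forall u, f u = 0 -> u = 0) -> injective f.
Proof.
move=> fL f0 u v uv; apply/eqP; rewrite -subr_eq0; apply/eqP/f0.
have -> : u - v = (-1) *: v + u by rewrite scaleN1r addrC.
by rewrite fL uv scaleN1r addNr.
Qed.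

Lemma lin_surj (K : choiceType) (U : lmodType rat) (L : U -> freeQ K) : linear L ->
  (forall k, exists x, L x = << k >>) -> forall y, exists x, L x = y.
Proof.
move=> LL H y; exists (lext (fun k => projT1 (cid (H k))) y).
rewrite (lin_lextK _ _ LL) [RHS]Defs.freeE; apply: eq_lext => k.
exact: (projT2 (cid (H k))).
Qed.

(** For surjectivity, induction on [nu k]: apart from its diagonal term, [L << k >>] is a
    combination of basis vectors of smaller [nu], which have preimages. *)
Lemma triangular_bij (K : choiceType) (nu : K -> nat) (L : freeQ K -> freeQ K) :
  linear L -> (forall k, (L << k >>)@_k != 0) ->
  (forall k l, (L << k >>)@_l != 0 -> (nu l < nu k)%N \/ k = l) -> bijective L.
Proof.
move=> LL Ld Lt; have LI : injective L.
  apply: lin_inj => // u Lu; apply: (triangular_upper_inj Ld Lt) => l.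
  have := lext_coeff (fun k => L << k >>) u l; rewrite -(lin_lext LL) Lu mcoeff0.
  by move=> <-.
have LS k : exists x, L x = << k >>.
  have [m] := ubnP (nu k); elim: m k => // m IHm k; rewrite ltnS => km.
  pose a := (L << k >>)@_k; pose r := L << k >> - a *: << k >>.
  have rk l : l \in msupp r -> (nu l < nu k)%N.
    rewrite -mcoeff_neq0 mcoeffB mcoeffZ mcoeffU /a.
    have [->|kl] := eqVneq k l; first by rewrite mulr1 subrr eqxx.
    by rewrite mulr0 subr0 => /Lt[] // e; rewrite e eqxx in kl.
  (* The membership condition is placed under the existential so that a preimage can be chosen for
     every [l], with 0 as default outside the support. *)
  have IH l : exists x, l \in msupp r -> L x = << l >>.
    have [/rk lk|] := boolP (l \in msupp r); last by exists 0.
    by have [x Lx] := IHm l (leq_trans lk km); exists x.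
  pose x := lext (fun l => projT1 (cid (IH l))) r.
  have Lx : L x = r.
    rewrite (lin_lextK _ _ LL) [RHS]Defs.freeE /lext big_seq [RHS]big_seq.
    by apply: eq_bigr => l lr; rewrite (projT2 (cid (IH l)) lr).
  (* From [L x = L << k >> - a *: << k >>], solve for [<< k >>]. *)
  exists (a^-1 *: (- 1 *: x + << k >>)).
  rewrite (linZ _ _ LL) LL Lx scaleN1r /r opprB addrNK scalerA.
  by rewrite mulVf ?scale1r // Ld.
have LS' := lin_surj LL LS.
exists (fun y => projT1 (cid (LS' y))) => y; last exact: (projT2 (cid (LS' y))).
by apply: LI; rewrite (projT2 (cid (LS' (L y)))).
Qed.

(** * The isomorphisms *)

Section PsiHat.
Variable reg : bool.

Definition mulT : freeQ gclass -> freeQ gclass -> freeQ gclass :=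
  if reg then mul_regmono else mul_mono.

Lemma mulT_bilin : (forall y, linear (mulT ^~ y)) /\ (forall x, linear (mulT x)).
Proof. by rewrite /mulT; case: reg; apply: lext2_bilin. Qed.

(** The counts behind both products constrain the two restrictions separately, which is [cmor] for
    [same_side]. *)
Lemma mulT_coeff s t c :
  (mulT << s >> << t >>)@_c =
  epi_coef reg (@same_side _ _) (gunion (rep s) (rep t)) c.
Proof.
rewrite /mulT /epi_coef; case: reg.
  apply: etrans (mul_regmono_coeff s t c) _; congr (_%:R / _); apply: eq_card => f.
  rewrite !inE !is_regmono_cmor; congr (_ && _); apply/esym.
  exact: cmor_gunion.
apply: etrans (mul_mono_coeff s t c) _; congr (_%:R / _); apply: eq_card => f.
rewrite !inE !is_mono_cmor; congr (_ && _); apply/esym.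
exact: cmor_gunion.
Qed.

(** The value at [t] of the counting function of an element; by [ev_inj] these values determine the
    element. *)
Definition ev (t : gclass) : freeQ gclass -> rat^o := lext (fun s => ncount reg s t : rat^o).

Lemma ev_linear t : linear (ev t).
Proof. exact: lext_linear. Qed.

Lemma evU t s : ev t << s >> = ncount reg s t.
Proof. exact: lextU. Qed.

Lemma ev_inj u v : (forall t, ev t u = ev t v) -> u = v.
Proof.
move=> uv; apply/eqP; rewrite -subr_eq0; apply/eqP.
apply: (triangular_lower_inj (ncount_self reg) (@ncount_neq0 reg)) => t.
have -> : u - v = (-1) *: v + u by rewrite scaleN1r addrC.
rewrite -/(ev t _) ev_linear uv scaleN1r; exact: addNr.
Qed.

(** By [factorization], evaluating a product of two classes counts the maps on their disjoint union
    that embed each summand, that is, pairs of embeddings. *)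
Lemma ev_mulT t u v : ev t (mulT u v) = ev t u * ev t v.
Proof.
have [mL mR] := mulT_bilin; have eL := ev_linear t.
move: u v; apply: (@lin_ext2 _ _ rat^o) => [y|x|y|x|s s'].
- exact: lin_comp eL (mL _).
- exact: lin_comp eL (mR _).
- by move=> a u v; rewrite eL mulrDl -scalerAl.
- by move=> a u v; rewrite eL mulrDr -scalerAr.
have E : mulT << s >> << s' >> =
    formal_sum (epi_coef reg (@same_side _ _) (gunion (rep s) (rep s'))).
  by apply/malgP=> c; rewrite epi_coefE mulT_coeff.
apply: etrans (f_equal (ev t) E) (etrans (factorization _ _ _ _) _).
apply: etrans _ (esym (f_equal2 *%R (evU t s) (evU t s'))).
rewrite -[RHS]natrM; congr (_%:R).
exact: card_cmor_gunion.
Qed.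

(** By [factorization] for the connectivity relation, the image of [c] has counting function
    [Ncount reg c]. *)
Definition psihat : freeQ gclass -> freeQ gclass :=
  lext (fun c => formal_sum (epi_coef reg (connect (adj (rep c))) (rep c))).

Lemma psihat_linear : linear psihat.
Proof. exact: lext_linear. Qed.

Lemma psihat_coeff c d :
  (psihat << c >>)@_d = epi_coef reg (connect (adj (rep c))) (rep c) d.
Proof. by rewrite /psihat lextU epi_coefE. Qed.

Lemma ev_psihat t c : ev t (psihat << c >>) = Ncount reg c t.
Proof. by rewrite /psihat lextU; apply: factorization. Qed.

(** The hypothesis holds for the empty graph too, so this fixes the unit as well as the
    generators. *)
Lemma psihat_connected c : (forall x y, connect (adj (rep c)) x y) ->
  psihat << c >> = << c >>.
Proof.
by move=> cc; apply: ev_inj => t; rewrite ev_psihat evU Ncount_connected.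
Qed.

Lemma psihat_cgen (t : cgraph) : psihat (cgen t) = cgen t.
Proof.
apply: psihat_connected => x y.
by have /andP[_ /forallP/(_ x)/forallP/(_ y)] := valP t.
Qed.

Lemma psihat_empty : psihat << empty_class >> = << empty_class >>.
Proof. by apply: psihat_connected => x; case: (rep_empty x). Qed.

Lemma psihat_mul x y : psihat (mul_hom x y) = mulT (psihat x) (psihat y).
Proof.
have [mL mR] := mul_hom_bilin; have [m'L m'R] := mulT_bilin; have pL := psihat_linear.
move: x y; apply: lin_ext2 => [y|x|y|x|s t].
- exact: lin_comp pL (mL _).
- exact: lin_comp pL (mR _).
- exact: lin_comp (m'L _) pL.
- exact: lin_comp (m'R _) pL.
apply: ev_inj => d; apply: etrans (f_equal (fun z => ev d (psihat z)) (mul_homE s t)) _.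
apply: etrans (ev_psihat _ _) (etrans (Ncount_gadd _ _ _ _) _).
by apply: esym (etrans (ev_mulT _ _ _) (f_equal2 *%R (ev_psihat _ _) (ev_psihat _ _))).
Qed.

(** A nonzero coefficient at [d] yields an epimorphism from [rep c] to [rep d], so [epi_coadj] gives
    triangularity; the identity makes the diagonal coefficients nonzero. *)
Lemma psihat_bij : bijective psihat.
Proof.
apply: (triangular_bij (nu := fun c => #|coadj_set (rep c)|) psihat_linear) => [c|c d].
  rewrite psihat_coeff mulf_neq0 ?invr_eq0 ?Aut_neq0 // pnatr_eq0 -lt0n.
  apply/card_gt0P; exists [ffun x => x]; rewrite inE; apply/andP; split.
    apply/epiP; split=> [x y||_ y y' yy'].
    + by rewrite !ffunE.
    + by move=> y; exists y; rewrite ffunE.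
    + by exists y, y'; rewrite !ffunE.
  by apply/cmorP; split=> [x y|x y _|r x y _]; rewrite !ffunE.
rewrite psihat_coeff mulf_eq0 negb_or pnatr_eq0 -lt0n => /andP[/card_gt0P[f + _]].
rewrite inE => /andP[fE _].
have /epi_coadj[] : is_epi (rep c) (rep d) f; last 1 [by left | by move/class_ofP; rewrite !class_of_rep; right].
by move: fE; rewrite /epi; case: reg => // /andP[].
Qed.

(** The analogue of [ev] on the tensor square. It separates elements by triangularity for the sum of
    the two sizes. *)
Definition ev2 (s t : gclass) : freeQ (gclass * gclass)%type -> rat^o :=
  lext (fun p => ncount reg p.1 s * ncount reg p.2 t : rat^o).

Lemma ev2_inj u v : (forall s t, ev2 s t u = ev2 s t v) -> u = v.
Proof.
move=> uv; apply/eqP; rewrite -subr_eq0; apply/eqP.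
apply: (@triangular_lower_inj _ (fun p => inc_size (rep p.1) + inc_size (rep p.2))%N
  (fun p q => ncount reg p.1 q.1 * ncount reg p.2 q.2)).
- by move=> p; rewrite mulf_neq0 ?ncount_self.
- move=> [a b] [c d] /=; rewrite mulf_eq0 negb_or => /andP[/ncount_neq0 + /ncount_neq0].
  case=> [lt|->] [lt'|->].
  + by left; rewrite -addnS leq_add // ltnW.
  + by left; rewrite ltn_add2r.
  + by left; rewrite ltn_add2l.
  + by right.
move=> [s t]; have eL : linear (ev2 s t) by apply: lext_linear.
have -> : u - v = (-1) *: v + u by rewrite scaleN1r addrC.
apply: etrans (eL _ _ _) _; rewrite uv scaleN1r; exact: addNr.
Qed.

(** An embedding into a disjoint union splits its source, and the coproduct sums over the same
    splittings. *)
Lemma ev2_cop s t u : ev2 s t (cop_hom' u) = ev (gadd s t) u.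
Proof.
have eL : linear (ev2 s t) by apply: lext_linear.
move: u; apply: lin_ext => [||c].
- exact: lin_comp eL cop_hom'_linear.
- exact: ev_linear.
rewrite evU ncount_split; exact: char_copE.
Qed.

Lemma ev2_tens s t x y : ev2 s t (tens x y) = ev s x * ev t y.
Proof.
have eL : linear (ev2 s t) by apply: lext_linear.
have sL := ev_linear s; have tL := ev_linear t.
move: x y; apply: (@lin_ext2 _ _ rat^o) => [y|x|y|x|k l].
- exact: lin_comp eL (lin_tensl _ (@lin_id _)).
- exact: lin_comp eL (lin_tensr _ (@lin_id _)).
- by move=> a u v; rewrite sL mulrDl -scalerAl.
- by move=> a u v; rewrite tL mulrDr -scalerAr.
rewrite tensU; apply: etrans (lextU _ _) _.
exact: esym (f_equal2 *%R (evU s k) (evU t l)).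
Qed.

Lemma ev2_tens_psihat s t z :
  ev2 s t (tens_map psihat psihat z) =
  lext (fun p => Ncount reg p.1 s * Ncount reg p.2 t : rat^o) z.
Proof.
have eL : linear (ev2 s t) by apply: lext_linear.
move: z; apply: lin_ext => [||[a b]].
- exact: lin_comp eL (@tens_map_linear _ _ _ _ _ _).
- exact: lext_linear.
rewrite tens_mapU lextU; apply: etrans (ev2_tens _ _ _ _) _.
by congr (_ * _); apply: ev_psihat.
Qed.

(* Ncount counts homomorphisms component by component, so it turns disjoint
   unions of the target into the coproduct of the source. *)
Lemma Ncount_cop s t c :
  Ncount reg c (gadd s t) =
  char_cop (fun p => Ncount reg p.1 s * Ncount reg p.2 t) c.
Proof.
have Ne d : Ncount reg empty_class d = 1.
  rewrite Ncount_connected ?ncount_empty // => x; by case: (rep_empty x).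
set w := fun p => _.
have w1 : w (empty_class, empty_class) = 1 by rewrite /w !Ne mulr1.
have wM a b a' b' : w (gadd a a', gadd b b') = w (a, b) * w (a', b').
  by rewrite /w /= !Ncount_gadd mulrACA.
elim/gclass_ind: c => [|c cc|a b IHa IHb].
- by rewrite Ne char_cop0.
- have conn x y : connect (adj (rep c)) x y.
    by have /andP[_ /forallP/(_ x)/forallP/(_ y)] := cc.
  rewrite char_cop_connected // Ncount_connected // -evU -ev2_cop.
  have [_ cg] := cop_hom'P.
  have E := cg (exist _ c cc); rewrite /= in E.
  have eL : linear (ev2 s t) by apply: lext_linear.
  apply: etrans (f_equal (ev2 s t) E) _.
  rewrite -[X in ev2 _ _ (X + _)]scale1r eL scale1r.
  apply: etrans (f_equal2 +%R (lextU _ _) (lextU _ _)) _.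
  by rewrite /w /= !Ne !ncount_empty !Ncount_connected.
- by rewrite Ncount_gadd IHa IHb char_cop_gadd.
Qed.

(** On a class [c], evaluation at [(s, t)] turns the left side into [Ncount] at the union of [s] and
    [t], and the right side into the coproduct of [c] evaluated by products of [Ncount]. *)
Lemma psihat_cop x : cop_hom' (psihat x) = tens_map psihat psihat (cop_hom' x).
Proof.
move: x; apply: lin_ext => [||c].
- exact: lin_comp cop_hom'_linear psihat_linear.
- exact: lin_comp (@tens_map_linear _ _ _ _ _ _) cop_hom'_linear.
apply: ev2_inj => s t; rewrite ev2_cop ev_psihat ev2_tens_psihat.
exact: Ncount_cop.
Qed.

Lemma psihat_eps x : (psihat x)@_empty_class = x@_empty_class.
Proof.
move: x; apply: (@lin_ext _ rat^o) => [||c].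
- exact: lin_comp eps_linear psihat_linear.
- exact: eps_linear.
rewrite [RHS]mcoeffU; case: eqP => [->|/eqP ce].
  by apply: etrans (f_equal (mcoeff _) psihat_empty) _; rewrite mcoeffU eqxx.
(* A nonempty graph has no map to the empty graph, so the coefficient vanishes. *)
rewrite psihat_coeff /epi_coef eq_card0 ?mul0r // => f; apply/negP => _.
have c0 : (0 < gorder c)%N by rewrite lt0n gorder_eq0.
exact: rep_empty (f (Ordinal c0)).
Qed.

Lemma psihat_hopf_equiv :
  hopf_equiv (hopf_of hom_hom') (hopf_with mulT cop_hom') psihat.
Proof.
split.
- by split; [exact: psihat_linear | exact: psihat_empty | exact: psihat_mul].
- exact: psihat_bij.
- exact: psihat_cop.
- exact: psihat_eps.
Qed.

End PsiHat.

Lemma hopf_equiv_cgen (d : dagger) : exists2 f,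
  hopf_equiv (hopf_of hom_hom') (hopf_of d) f & forall t, f (cgen t) = cgen t.
Proof.
(* The equivalence for a primed product divides by [aut_weight], applies [f], then multiplies by
   [Aut]; on a connected graph the two scalars cancel. *)
have dual d1 d2 f : hopf_equiv (hopf_of hom_hom') (hopf_of d1) f ->
    (forall t, f (cgen t) = cgen t) ->
    hopf_equiv (hopf_of d1) (hopf_of d2) (diag (fun c => (Aut c)%:R)) ->
    exists2 f', hopf_equiv (hopf_of hom_hom') (hopf_of d2) f'
              & forall t, f' (cgen t) = cgen t.
  move=> fE fg DE; have [[fL _ _] _ _ _] := fE.
  have E := hopf_equiv_comp (hopf_equiv_comp hopf_equiv_aut_weight fE) DE.
  exists (fun x => diag (fun c => (Aut c)%:R) (f (diag (fun c => (aut_weight c)^-1) x))).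
    exact: E.
  move=> t; rewrite diag_weight_cgen (linZ _ _ fL) fg (linZ _ _ (diag_linear _)).
  by rewrite diag_Aut_cgen scalerA mulVf ?scale1r // Aut_neq0.
have id_equiv : hopf_equiv (hopf_of hom_hom') (hopf_of hom_hom') id.
  split=> //; first by exists id.
  by move=> x; rewrite tens_map_id.
case: d.
- by exists id.
- exact: dual id_equiv (fun=> erefl) hopf_equiv_hom'_hom.
- by exists (psihat false); [exact: psihat_hopf_equiv | exact: psihat_cgen].
- exact: @dual mono_hom' _ _ (psihat_hopf_equiv false) (psihat_cgen false) hopf_equiv_mono'_hom.
- by exists (psihat true); [exact: psihat_hopf_equiv | exact: psihat_cgen].
- exact: @dual regmono_hom' _ _ (psihat_hopf_equiv true) (psihat_cgen true) hopf_equiv_regmono'_hom.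
Qed.

Theorem theorem2p7 : forall d : dagger,
  [/\ is_hopf (hopf_of d),
      exists psihat,
        natural_extension (hopf_of hom_hom') cgen (hopf_of d) psi psihat /\
        hopf_isomorphism (hopf_of hom_hom') (hopf_of d) psihat
    & freely_generated (hopf_of d) cgen].
Proof.
move=> d; have [f fE fg] := hopf_equiv_cgen d; split.
- exact: hopf_transport fE hom_hom'_hopf.
- exists f; split; last exact: hopf_equiv_isomorphism fE hom_hom'_hopf.
  have [fM _ _ _] := fE; have psiU i : psi << i >> = cgen i by apply: lextU.
  split; first by split=> // i; rewrite fg psiU.
  (* Uniqueness of the extension holds because the connected graphs generate the source algebra. *)
  move=> f' [f'M f'g]; apply: hom_morphism_ext f'M fM _ => t.
  exact: etrans (f'g t) (etrans (psiU t) (esym (fg t))).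
- exact (freely_generated_transport fE fg hom_hom'_free).
Qed.
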